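(* Let $K$ be an abelian number field of odd degree with Galois group $G_K$, and let $\chi$ be an $\overline{\mathbb{F}}_2$-character of $G_K$. Then: (a) if $k^+_\chi(K)=1$, then $\operatorname{sgnrk}_\chi(\mathcal{O}_K^\times)=0$; (b) if $k^+_\chi(K)=0$, then $\max(0,1-\rho_\chi(K))\le\operatorname{sgnrk}_\chi(\mathcal{O}_K^\times)\le 1$.
   Context: $K$ is totally real. Let $V_\infty(K)=\bigoplus_{v\text{ real}}\{\pm1\}\simeq\mathbb{F}_2^{n}$ (sum over the real places of $K$), with $G_K$ acting by permuting places ($v\mapsto v\circ\sigma^{-1}$), and let $\operatorname{sgn}_\infty\colon K^\times\to V_\infty(K)$ record the signs $v(\alpha)/|v(\alpha)|$; it is $G_K$-equivariant, so $\operatorname{sgn}_\infty(\mathcal{O}_K^\times)$ is an $\mathbb{F}_2[G_K]$-module. Fix an algebraic closure $\overline{\mathbb{F}}_2$; an $\overline{\mathbb{F}}_2$-character is a homomorphism $\chi\colon G_K\to\overline{\mathbb{F}}_2^\times$, $\mathbb{F}_2(\chi)$ the subfield generated by its values, an irreducible $\mathbb{F}_2[G_K]$-module with $\sigma$ acting by multiplication by $\chi(\sigma)$. $\operatorname{sgnrk}_\chi(\mathcal{O}_K^\times)$ is the multiplicity of $\mathbb{F}_2(\chi)$ in $\operatorname{sgn}_\infty(\mathcal{O}_K^\times)$. For a finitely generated $\mathbb{Z}[G_K]$-module $M$, $\operatorname{rk}_\chi M$ is the multiplicity of $\mathbb{F}_2(\chi)$ in $M/M^2$. $\rho_\chi(K):=\operatorname{rk}_\chi\operatorname{Cl}(K)$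 and $k^+_\chi(K):=\operatorname{rk}_\chi\operatorname{Cl}^+(K)-\operatorname{rk}_\chi\operatorname{Cl}(K)$, where $\operatorname{Cl}(K)$, $\operatorname{Cl}^+(K)$ are the class group and narrow class group. *)

(* Defs.v *)
From HB Require Import structures.
From mathcomp Require Import all_boot all_order all_algebra all_fingroup.
From mathcomp Require Import generic_quotient ring_quotient all_field.
From mathcomp Require Import boolp classical_sets functions reals.

Set Implicit Arguments.
Unset Strict Implicit.
Unset Printing Implicit Defensive.

Import Order.TTheory GRing.Theory Num.Theory.
Local Open Scope classical_set_scope.
Local Open Scope ring_scope.
Local Open Scope quotient_scope.

(* The order of composition in [gmod_actM] is that of [galM]:
   (g * h) x = h (g x) in [gal_of E]. It is immaterial for abelian groups. *)
Record gmodule (gT : finGroupType) := GModule {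
  gmod_sort :> zmodType;
  gmod_act : gT -> gmod_sort -> gmod_sort;
  gmod_actD : forall g, {morph gmod_act g : x y / x + y};
  gmod_act1 : forall x, gmod_act 1%g x = x;
  gmod_actM : forall g h x, gmod_act (g * h)%g x = gmod_act h (gmod_act g x)
}.

Record gsubmodule (gT : finGroupType) (M : gmodule gT) := GSubmodule {
  gsub_set : set M;
  gsub0 : gsub_set 0;
  gsubB : forall x y, gsub_set x -> gsub_set y -> gsub_set (x - y);
  gsub_stable : forall g x, gsub_set x -> gsub_set (gmod_act g x)
}.

Section GModuleConstructions.
Variable gT : finGroupType.
Implicit Types M N S : gmodule gT.

Lemma gmod_act0 M g : gmod_act g (0 : M) = 0.
Proof. by apply: (addrI (gmod_act g 0)); rewrite -gmod_actD !addr0. Qed.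

Lemma gmod_actB M g : {morph gmod_act g : x y / x - y : M}.
Proof.
move=> x y; apply: (addIr (gmod_act g y)).
by rewrite -gmod_actD !subrK.
Qed.

Definition gsub_mem M (P : gsubmodule M) : {pred M} := fun x => `[< gsub_set P x >].

Lemma gsub_zmod_closed M (P : gsubmodule M) : zmod_closed (gsub_mem P).
Proof.
split; first by apply/asboolP/gsub0.
by move=> x y /asboolP Px /asboolP Py; apply/asboolP/gsubB.
Qed.

HB.instance Definition _ M (P : gsubmodule M) :=
  GRing.isZmodClosed.Build M (gsub_mem P) (gsub_zmod_closed P).

Section Sub.
Variables (M : gmodule gT) (P : gsubmodule M).

Definition gsub_type := {x : M | x \in gsub_mem P}.
HB.instance Definition _ := SubChoice.on gsub_type.
HB.instance Definition _ := [SubChoice_isSubZmodule of gsub_type by <:].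

Lemma gsub_actP g (x : gsub_type) : gmod_act g (val x) \in gsub_mem P.
Proof. by apply/asboolP/gsub_stable/asboolP/(valP x). Qed.

Definition gsub_act g (x : gsub_type) : gsub_type :=
  exist _ (gmod_act g (val x)) (gsub_actP g x).

Lemma gsub_actD g : {morph gsub_act g : x y / x + y}.
Proof. by move=> x y; apply: val_inj; rewrite /= gmod_actD. Qed.

Lemma gsub_act1 x : gsub_act 1%g x = x.
Proof. by apply: val_inj; rewrite /= gmod_act1. Qed.

Lemma gsub_actM g h x : gsub_act (g * h)%g x = gsub_act h (gsub_act g x).
Proof. by apply: val_inj; rewrite /= gmod_actM. Qed.

Definition gmod_sub : gmodule gT := GModule gsub_actD gsub_act1 gsub_actM.
End Sub.

Section Quot.
Variables (M : gmodule gT) (P : gsubmodule M).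

Local Notation Q := {ideal_quot gsub_mem P}.

Definition gquot_act g (x : Q) : Q := \pi_Q (gmod_act g (repr x)).

Lemma gquot_act_pi g (x : M) : gquot_act g (\pi_Q x) = \pi_Q (gmod_act g x).
Proof.
rewrite /gquot_act; apply/eqP; rewrite -Quotient.idealrBE -gmod_actB.
by apply/asboolP/gsub_stable/asboolP; rewrite -[`[< _ >]]/(_ \in gsub_mem P)
  Quotient.idealrBE reprK.
Qed.

Lemma gquot_actD g : {morph gquot_act g : x y / x + y}.
Proof.
have piD a b : \pi_Q (a + b) = \pi_Q a + \pi_Q b by apply: Quotient.pi_add.
move=> x y; rewrite -[x]reprK -[y]reprK -piD.
by rewrite !gquot_act_pi gmod_actD piD.
Qed.

Lemma gquot_act1 x : gquot_act 1%g x = x.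
Proof. by rewrite -[x]reprK gquot_act_pi gmod_act1. Qed.

Lemma gquot_actM g h x : gquot_act (g * h)%g x = gquot_act h (gquot_act g x).
Proof. by rewrite -[x]reprK [gquot_act g _]gquot_act_pi !gquot_act_pi gmod_actM. Qed.

Definition gmod_quot : gmodule gT := GModule gquot_actD gquot_act1 gquot_actM.
End Quot.

Section Pow.
Variables (M : gmodule gT) (m : nat).

Definition gpow_act g (f : {ffun 'I_m -> M}) : {ffun 'I_m -> M} :=
  [ffun i => gmod_act g (f i)].

Lemma gpow_actD g : {morph gpow_act g : x y / x + y}.
Proof. by move=> x y; apply/ffunP => i; rewrite !ffunE gmod_actD. Qed.

Lemma gpow_act1 x : gpow_act 1%g x = x.
Proof. by apply/ffunP => i; rewrite !ffunE gmod_act1. Qed.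

Lemma gpow_actM g h x : gpow_act (g * h)%g x = gpow_act h (gpow_act g x).
Proof. by apply/ffunP => i; rewrite !ffunE gmod_actM. Qed.

Definition gmod_pow : gmodule gT := GModule gpow_actD gpow_act1 gpow_actM.
End Pow.

Section Sum.
Variables M N : gmodule gT.

Definition gsum_act g (x : M * N) : M * N := (gmod_act g x.1, gmod_act g x.2).

Lemma gsum_actD g : {morph gsum_act g : x y / x + y}.
Proof. by move=> x y; rewrite /gsum_act /= !gmod_actD. Qed.

Lemma gsum_act1 x : gsum_act 1%g x = x.
Proof. by case: x => a b; rewrite /gsum_act /= !gmod_act1. Qed.

Lemma gsum_actM g h x : gsum_act (g * h)%g x = gsum_act h (gsum_act g x).
Proof. by rewrite /gsum_act /= !gmod_actM. Qed.

Definition gmod_sum : gmodule gT := GModule gsum_actD gsum_act1 gsum_actM.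
End Sum.

Definition gmod_hom M N (f : M -> N) : Prop :=
  {morph f : x y / x + y} /\ forall g x, f (gmod_act g x) = gmod_act g (f x).

Definition gmod_isom M N : Prop := exists2 f : M -> N, gmod_hom f & bijective f.

Definition gmod_has_copy S M : Prop :=
  exists P : gsubmodule M, gmod_isom S (gmod_sub P).

(* Multiplicity of an irreducible S in a semisimple M: M is isomorphic to
   S^m + N, where N contains no copy of S. *)
Definition is_multiplicity S M (m : nat) : Prop :=
  exists2 N : gmodule gT, ~ gmod_has_copy S N &
    gmod_isom (gmod_sum (gmod_pow S m) N) M.

(* For finite M of exponent 2 and gT of odd order such an m exists and is
   unique; 0 is a junk value. *)
Definition multiplicity S M : nat := xget 0%N [set m | is_multiplicity S M m].

Section Mod2.
Variable M : gmodule gT.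

Definition double_set : set M := [set x | exists y, x = y + y].

Lemma double_set0 : double_set 0.
Proof. by exists 0; rewrite addr0. Qed.

Lemma double_setB x y : double_set x -> double_set y -> double_set (x - y).
Proof. by move=> [a ->] [b ->]; exists (a - b); rewrite opprD addrACA. Qed.

Lemma double_set_stable g x : double_set x -> double_set (gmod_act g x).
Proof. by move=> [a ->]; exists (gmod_act g a); rewrite gmod_actD. Qed.

Definition gmod_double : gsubmodule M :=
  GSubmodule double_set0 double_setB double_set_stable.

(* M / 2M, i.e. M / M^2 in multiplicative notation. *)
Definition gmod_mod2 : gmodule gT := gmod_quot gmod_double.
End Mod2.

End GModuleConstructions.

Record character (gT : finGroupType) (F : fieldType) := Character {
  char_fun :> gT -> F;
  char_1 : char_fun 1%g = 1;
  char_M : {morph char_fun : g h / (g * h)%g >-> g * h}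
}.

Section CharacterModule.
Variables (gT : finGroupType) (F : fieldType) (chi : character gT F).

Lemma char_actD g : {morph (fun x : F => chi g * x) : x y / x + y}.
Proof. by move=> x y; rewrite mulrDr. Qed.

Lemma char_act1 x : chi 1%g * x = x.
Proof. by rewrite char_1 mul1r. Qed.

Lemma char_actM g h x : chi (g * h)%g * x = chi h * (chi g * x).
Proof. by rewrite char_M mulrA [chi h * _]mulrC. Qed.

Definition char_big_module : gmodule gT :=
  @GModule gT F (fun g x => chi g * x) char_actD char_act1 char_actM.

(* The subfield of F generated by the values of chi. *)
Definition char_field : set F :=
  [set x | forall E : {pred F},
     divring_closed E -> (forall g, chi g \in E) -> x \in E].

Lemma char_field0 : char_field 0.
Proof. by move=> E [E1 EB _] _; rewrite -(subrr 1); apply: EB. Qed.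

Lemma char_fieldB x y : char_field x -> char_field y -> char_field (x - y).
Proof. by move=> Fx Fy E EP cE; have [_ EB _] := EP; apply: EB; auto. Qed.

Lemma char_field_stable g x : char_field x -> char_field (chi g * x).
Proof.
move=> Fx E EP cE; have [E1 EB Ed] := EP.
have Ex := Fx E EP cE; have Exi : x^-1 \in E by rewrite -[x^-1]mul1r; apply: Ed.
by rewrite -[x]invrK; apply: Ed.
Qed.

(* F_2(chi), when F is an algebraic closure of F_2. *)
Definition char_module : gmodule gT :=
  gmod_sub (@GSubmodule gT char_big_module
    char_field char_field0 char_fieldB char_field_stable).
End CharacterModule.

Section NumberField.
Variables (R : realType) (K : splittingFieldType rat).

Notation galK := (gal_of {:K}%VS).

Definition intring : set K := [set x | integralOver (intr : int -> K) x].

Definition intunit : set K := [set x | [/\ x != 0, intring x & intring x^-1]].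

Lemma intring_gal (g : galK) x : intring x -> intring (g x).
Proof.
case=> p mon_p px0; exists p => //.
have -> : map_poly intr p = map_poly g (map_poly intr p) :> {poly K}.
  by rewrite -map_poly_comp; apply: eq_map_poly => a /=; rewrite rmorph_int.
exact: rmorph_root.
Qed.

Lemma galKM (g h : galK) x : (g * h)%g x = h (g x).
Proof. by rewrite galM ?memvf. Qed.

Lemma galKV (g : galK) x : g (g^-1%g x) = x.
Proof. by rewrite -galKM mulVg gal_id. Qed.

Definition real_place : Type := {rmorphism K -> R}.

Definition place_gal (v : real_place) (g : galK) : real_place := v \o g.

(* The sign group {1, -1} is identified with F_2 (-1 corresponding to 1).
   There are finitely many real places, so all functions are allowed.
   As g sends a place v to v \o g^-1, it sends f to the function v |-> f (v \o g). *)
Definition Vinf_type : zmodType := real_place -> 'F_2.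

Definition Vinf_act (g : galK) (f : Vinf_type) : Vinf_type :=
  fun v => f (place_gal v g).


Lemma real_place_eq (v w : real_place) : v =1 w -> v = w.
Proof.
case: v w => [v cv] [w cw] /= /funext vw; case: _ / vw cw => cw.
congr GRing.RMorphism.Pack; case: cv cw => [[a] [b]] [[a'] [b']].
by rewrite (Prop_irrelevance a a') (Prop_irrelevance b b').
Qed.

Lemma Vinf_actD g : {morph Vinf_act g : x y / x + y}.
Proof. by []. Qed.

Lemma Vinf_act1 f : Vinf_act 1%g f = f.
Proof.
apply/funext => v; congr f; apply: real_place_eq => x.
by rewrite /place_gal /= gal_id.
Qed.

Lemma Vinf_actM g h f : Vinf_act (g * h)%g f = Vinf_act h (Vinf_act g f).
Proof.
apply/funext => v; congr f; apply: real_place_eq => x.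
by rewrite /place_gal /= galKM.
Qed.

Definition Vinf : gmodule galK := GModule Vinf_actD Vinf_act1 Vinf_actM.

Definition sgninf (x : K) : Vinf := fun v : real_place => (v x < 0)%R%:R.

Lemma sgninfM (x y : K) : x != 0 -> y != 0 -> sgninf (x * y) = sgninf x + sgninf y.
Proof.
move=> x0 y0; apply/funext => v.
have -> : (sgninf x + sgninf y) v = sgninf x v + sgninf y v by [].
rewrite /sgninf rmorphM /=.
have vx : v x != 0 by rewrite fmorph_eq0.
have vy : v y != 0 by rewrite fmorph_eq0.
case: (ltgtP (v x) 0) vx => // hx _; case: (ltgtP (v y) 0) vy => // hy _.
- by rewrite nmulr_rlt0 // ltNge ltW //=; apply: val_inj.
- by rewrite nmulr_rlt0 // hy addr0.
- by rewrite pmulr_rlt0 // hy add0r.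
- by rewrite pmulr_rlt0 // ltNge ltW //= addr0.
Qed.

Lemma sgninf1 : sgninf 1 = 0.
Proof. by apply/funext => v; rewrite /sgninf rmorph1 ltr10. Qed.

Lemma sgninf_gal (g : galK) x : sgninf (g x) = gmod_act g (sgninf x).
Proof. by []. Qed.

Lemma sgninfV (x : K) : x != 0 -> sgninf x^-1 = - sgninf x.
Proof.
move=> x0; apply: (addIr (sgninf x)).
by rewrite -sgninfM ?invr_eq0 // mulVf // addNr sgninf1.
Qed.

Definition sgn_units_set : set Vinf := sgninf @` intunit.

Lemma sgn_units0 : sgn_units_set 0.
Proof.
exists 1; last exact: sgninf1.
by split; rewrite ?oner_eq0 ?invr1 //; apply: integral1.
Qed.

Lemma sgn_unitsB f h :
  sgn_units_set f -> sgn_units_set h -> sgn_units_set (f - h).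
Proof.
move=> [x [x0 Ox Oxi] <-] [y [y0 Oy Oyi] <-]; exists (x / y).
  split; first by rewrite mulf_neq0 ?invr_eq0.
    exact: integral_mul.
  by rewrite invf_div; apply: integral_mul.
by rewrite sgninfM ?invr_eq0 // sgninfV.
Qed.

Lemma sgn_units_stable g f :
  sgn_units_set f -> sgn_units_set (gmod_act g f).
Proof.
move=> [x [x0 Ox Oxi] <-]; exists (g x); last exact: sgninf_gal.
by split; [rewrite fmorph_eq0 | apply: intring_gal |
  rewrite -fmorphV; apply: intring_gal].
Qed.

(* sgn_infty(O_K^x) *)
Definition sgn_units : gmodule galK :=
  gmod_sub (GSubmodule sgn_units0 sgn_unitsB sgn_units_stable).

Definition fractional_ideal (I : set K) : Prop :=
  [/\ [/\ I 0, forall x y, I x -> I y -> I (x + y)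
        & forall a x, intring a -> I x -> I (a * x)],
      exists2 x, I x & x != 0
    & exists2 d, intring d /\ d != 0 & forall x, I x -> intring (d * x)].

Definition ideal_mul (I J : set K) : set K :=
  [set x | exists2 s : seq (K * K),
     (forall p, p \in s -> I p.1 /\ J p.2) & x = \sum_(p <- s) p.1 * p.2].

(* O_K being a Dedekind domain, every fractional ideal is invertible. *)
Definition invertible_ideal (I : set K) : Prop :=
  fractional_ideal I /\
  exists2 J, fractional_ideal J & ideal_mul I J = intring.

Lemma intring0 : intring 0. Proof. exact: integral0. Qed.
Lemma intring1 : intring 1. Proof. exact: integral1. Qed.
Lemma intringD x y : intring x -> intring y -> intring (x + y).
Proof. exact: integral_add. Qed.
Lemma intringM x y : intring x -> intring y -> intring (x * y).
Proof. exact: integral_mul. Qed.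

Lemma ideal_mul_sub (I J A : set K) : A 0 ->
  (forall x y, A x -> A y -> A (x + y)) ->
  (forall x y, I x -> J y -> A (x * y)) -> ideal_mul I J `<=` A.
Proof.
move=> A0 AD AM _ [s sP ->]; rewrite big_seq; apply: big_ind => // p /sP[].
exact: AM.
Qed.

Lemma ideal_mul0 I J : ideal_mul I J 0.
Proof. by exists [::]; rewrite ?big_nil. Qed.

Lemma ideal_mulD I J x y :
  ideal_mul I J x -> ideal_mul I J y -> ideal_mul I J (x + y).
Proof.
move=> [s sP ->] [t tP ->]; exists (s ++ t); rewrite ?big_cat // => p.
by rewrite mem_cat => /orP[/sP|/tP].
Qed.

Lemma ideal_mulM (I J : set K) x y : I x -> J y -> ideal_mul I J (x * y).
Proof.
by move=> Ix Jy; exists [:: (x, y)]; rewrite ?big_seq1 // => p /[!inE]/eqP ->.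
Qed.

Lemma ideal_mulC I J : ideal_mul I J = ideal_mul J I.
Proof.
suff sub I' J' : ideal_mul I' J' `<=` ideal_mul J' I'.
  by apply/seteqP; split.
apply: ideal_mul_sub; [exact: ideal_mul0 | exact: ideal_mulD |].
by move=> x y Ix Jy; rewrite mulrC; apply: ideal_mulM.
Qed.

Lemma ideal_mulA I J L :
  ideal_mul I (ideal_mul J L) = ideal_mul (ideal_mul I J) L.
Proof.
have sub I' J' L' :
    ideal_mul I' (ideal_mul J' L') `<=` ideal_mul (ideal_mul I' J') L'.
  apply: ideal_mul_sub; [exact: ideal_mul0 | exact: ideal_mulD |].
  move=> x y Ix; move: y.
  apply: (@ideal_mul_sub J' L'
    [set y | ideal_mul (ideal_mul I' J') L' (x * y)]) => /=.
  - by rewrite mulr0; apply: ideal_mul0.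
  - by move=> y z ? ?; rewrite mulrDr; apply: ideal_mulD.
  by move=> y z Jy Lz; rewrite mulrA; do 2?apply: ideal_mulM.
apply/seteqP; split; first exact: sub.
rewrite (ideal_mulC (ideal_mul I J)) (ideal_mulC I J).
by rewrite (ideal_mulC I (ideal_mul J L)) (ideal_mulC J L); apply: sub.
Qed.

Lemma fractional_mul I J : fractional_ideal I -> fractional_ideal J ->
  fractional_ideal (ideal_mul I J).
Proof.
move=> [[I0 ID IM] [x Ix x0] [d [Od d0] dI]].
move=> [[J0 JD JM] [y Jy y0] [e [Oe e0] eJ]]; split.
- split; [exact: ideal_mul0 | exact: ideal_mulD |].
  move=> a z Oa; move: z.
  apply: (@ideal_mul_sub I J [set z | ideal_mul I J (a * z)]) => /=.
  + by rewrite mulr0; apply: ideal_mul0.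
  + by move=> ? ? ? ?; rewrite mulrDr; apply: ideal_mulD.
  by move=> u w Iu Jw; rewrite mulrA; apply: ideal_mulM => //; apply: IM.
- by exists (x * y); [apply: ideal_mulM | rewrite mulf_neq0].
- exists (d * e); first by split; [apply: intringM | rewrite mulf_neq0].
  apply: (@ideal_mul_sub I J [set z | intring (d * e * z)]) => /=.
  + by rewrite mulr0; apply: intring0.
  + by move=> ? ? ? ?; rewrite mulrDr; apply: intringD.
  by move=> u w Iu Jw; rewrite mulrACA; apply: intringM; [apply: dI | apply: eJ].
Qed.

Lemma ideal_mul1 I : fractional_ideal I -> ideal_mul intring I = I.
Proof.
move=> [[I0 ID IM] _ _]; apply/seteqP; split; first exact: ideal_mul_sub.
by move=> x Ix; rewrite -[x]mul1r; apply: ideal_mulM => //; apply: intring1.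
Qed.

Definition principal_ideal (x : K) : set K := [set x * a | a in intring].


Lemma intring_denominator (x : K) : exists2 d : K, d != 0 & intring d /\ intring (d * x).
Proof.
have [p1 Dp1] := polyOver1P (minPolyOver 1 x).
have [q [a a0 Dq]] := rat_poly_scale p1.
have pE i : (minPoly 1 x)`_i = a%:~R^-1 * (q`_i)%:~R.
  have p1E : p1`_i = a%:~R^-1 * (q`_i)%:~R by rewrite Dq coefZ coef_map.
  pose f : {rmorphism rat -> K} := GRing.in_alg K.
  transitivity (f (a%:~R^-1 * (q`_i)%:~R)); last first.
    by rewrite rmorphM fmorphV !rmorph_int.
  by rewrite -p1E Dp1 coef_map.
pose n := (size (minPoly 1 x)).-1.
have sz : size (minPoly 1 x) = n.+1.
  by rewrite prednK // lt0n size_poly_eq0 monic_neq0 ?monic_minPoly.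
have lc : (minPoly 1 x)`_n = 1.
  by have /monicP := monic_minPoly 1 x; rewrite lead_coefE.
have aK0 : (a%:~R : K) != 0.
  by rewrite -(rmorph_int (GRing.in_alg K)) fmorph_eq0 intr_eq0.
have Oa : intring a%:~R by apply: integral_id.
exists a%:~R => //; split=> //.
pose P : {poly K} := \poly_(i < n.+1) (a%:~R ^+ (n - i) * (minPoly 1 x)`_i).
have PE i : (i <= n)%N -> P`_i = a%:~R ^+ (n - i) * (minPoly 1 x)`_i.
  by move=> le_in; rewrite coef_poly ltnS le_in.
have szP : size P = n.+1.
  by apply: size_poly_eq; rewrite subnn lc mulr1 oner_neq0.
apply: (@integral_root_monic _ _ _ _ P).
- by rewrite monicE lead_coefE szP /= PE // subnn lc mulr1.
- rewrite /root horner_poly.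
  have := minPolyxx 1 x; rewrite horner_coef sz => mx0.
  apply/eqP; transitivity (a%:~R ^+ n * 0 : K); last by rewrite mulr0.
  rewrite -[in RHS]mx0 mulr_sumr; apply: eq_bigr => i _.
  by rewrite exprMn mulrACA -exprD subnK // -ltnS.
- apply/integral_poly => i.
  case: (ltngtP i n) => [lt_in|lt_ni|->].
  + rewrite PE 1?ltnW // pE mulrA.
    have -> : (n - i = (n - i).-1.+1)%N by rewrite prednK // subn_gt0.
    rewrite exprSr mulfK //; apply: integral_mul; last exact: integral_id.
    by rewrite -rmorphXn; apply: integral_id.
  + by rewrite coef_poly ltnS leqNgt lt_ni; apply: intring0.
  + by rewrite PE // subnn lc mulr1; apply: intring1.
Qed.

Lemma principal_fractional x : x != 0 -> fractional_ideal (principal_ideal x).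
Proof.
move=> x0; split.
- split; first by exists 0; [exact: intring0 | rewrite mulr0].
    move=> _ _ [a Oa <-] [b Ob <-].
    by exists (a + b); [apply: intringD | rewrite mulrDr].
  move=> a _ Oa [b Ob <-].
  by exists (a * b); [apply: intringM | rewrite mulrCA].
- by exists x => //; exists 1; [exact: intring1 | rewrite mulr1].
- have [d d0 [Od Odx]] := intring_denominator x.
  exists d => // _ [a Oa <-]; rewrite mulrA; exact: intringM.
Qed.

Lemma principal_mul x y :
  ideal_mul (principal_ideal x) (principal_ideal y) = principal_ideal (x * y).
Proof.
apply/seteqP; split.
  apply: ideal_mul_sub.
  - by exists 0; [exact: intring0 | rewrite mulr0].
  - move=> _ _ [a Oa <-] [b Ob <-].
    by exists (a + b); [apply: intringD | rewrite mulrDr].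
  - move=> _ _ [a Oa <-] [b Ob <-].
    by exists (a * b); [apply: intringM | rewrite mulrACA].
move=> _ [a Oa <-]; rewrite -mulrA; apply: ideal_mulM; last by exists a.
by exists 1; [exact: intring1 | rewrite mulr1].
Qed.

Lemma principal1 : principal_ideal 1 = intring.
Proof.
apply/seteqP; split=> [_ [a Oa <-]|a Oa]; first by rewrite mul1r.
by exists a; rewrite ?mul1r.
Qed.

Lemma principal_invertible x : x != 0 -> invertible_ideal (principal_ideal x).
Proof.
move=> x0; split; first exact: principal_fractional.
exists (principal_ideal x^-1); first by apply: principal_fractional; rewrite invr_eq0.
by rewrite principal_mul mulfV // principal1.
Qed.

Lemma intring_fractional : fractional_ideal intring.
Proof. by rewrite -principal1; apply: principal_fractional (oner_neq0 _). Qed.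

Lemma intring_invertible : invertible_ideal intring.
Proof. by rewrite -principal1; apply: principal_invertible (oner_neq0 _). Qed.

Lemma invertible_mul I J :
  invertible_ideal I -> invertible_ideal J -> invertible_ideal (ideal_mul I J).
Proof.
move=> [fI [I' fI' II']] [fJ [J' fJ' JJ']]; split; first exact: fractional_mul.
exists (ideal_mul J' I'); first exact: fractional_mul.
by rewrite ideal_mulA -(ideal_mulA I) JJ' (ideal_mulC I) ideal_mul1.
Qed.

(* (O_K : I) *)
Definition ideal_inv (I : set K) : set K :=
  [set x | forall y, I y -> intring (x * y)].

Lemma ideal_invE I J : fractional_ideal I -> fractional_ideal J ->
  ideal_mul I J = intring -> ideal_inv I = J.
Proof.
move=> fI fJ IJ; apply/seteqP; split=> [x xI|x Jx y Iy]; last first.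
  by rewrite -IJ mulrC; apply: ideal_mulM.
have [[J0 JD JM] _ _] := fJ.
have : ideal_mul I J 1 by rewrite IJ; apply: intring1.
rewrite -[J x]/(J x) -[x in J x]mulr1.
move: 1; apply: (@ideal_mul_sub I J [set y | J (x * y)]) => /=.
- by rewrite mulr0.
- by move=> y z ? ?; rewrite mulrDr; apply: JD.
- by move=> y z Iy Jz; rewrite mulrA; apply: JM => //; apply: xI.
Qed.

Lemma invertible_inv I : invertible_ideal I -> invertible_ideal (ideal_inv I).
Proof.
move=> [fI [J fJ IJ]]; rewrite (ideal_invE fI fJ IJ).
by split=> //; exists I; rewrite // ideal_mulC.
Qed.

Lemma ideal_mulV I : invertible_ideal I -> ideal_mul (ideal_inv I) I = intring.
Proof.
by move=> [fI [J fJ IJ]]; rewrite (ideal_invE fI fJ IJ) ideal_mulC.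
Qed.

Definition ideal_group := {I : set K | `[< invertible_ideal I >]}.
HB.instance Definition _ := SubChoice.on ideal_group.

Definition mk_ideal I (invI : invertible_ideal I) : ideal_group :=
  exist _ I (asboolT invI).

Definition ideal_set (I : ideal_group) : set K := sval I.

Lemma ideal_setP (I : ideal_group) : invertible_ideal (ideal_set I).
Proof. exact/asboolP/(valP I). Qed.

Lemma ideal_set_inj : injective ideal_set. Proof. exact: val_inj. Qed.

Definition ig_add (I J : ideal_group) : ideal_group :=
  mk_ideal (invertible_mul (ideal_setP I) (ideal_setP J)).
Definition ig_zero : ideal_group := mk_ideal intring_invertible.
Definition ig_opp (I : ideal_group) : ideal_group :=
  mk_ideal (invertible_inv (ideal_setP I)).

Lemma ig_addA : associative ig_add.
Proof. by move=> I J L; apply: ideal_set_inj; apply: ideal_mulA. Qed.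
Lemma ig_addC : commutative ig_add.
Proof. by move=> I J; apply: ideal_set_inj; apply: ideal_mulC. Qed.
Lemma ig_add0 : left_id ig_zero ig_add.
Proof.
by move=> I; apply: ideal_set_inj; apply: ideal_mul1; have [] := ideal_setP I.
Qed.
Lemma ig_addN : left_inverse ig_zero ig_opp ig_add.
Proof.
by move=> I; apply: ideal_set_inj; apply: ideal_mulV; apply: ideal_setP.
Qed.

(* The ideal group in additive notation: I + J is the product of ideals. *)
HB.instance Definition _ :=
  GRing.isZmodule.Build ideal_group ig_addA ig_addC ig_add0 ig_addN.

Definition ideal_gal (g : galK) (I : set K) : set K := g @` I.

Lemma ideal_galM g I J :
  ideal_gal g (ideal_mul I J) = ideal_mul (ideal_gal g I) (ideal_gal g J).
Proof.
apply/seteqP; split.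
  move=> _ [x IJx <-]; move: x IJx.
  apply: (@ideal_mul_sub I J
    [set x | ideal_mul (ideal_gal g I) (ideal_gal g J) (g x)]) => /=.
  - by rewrite rmorph0; apply: ideal_mul0.
  - by move=> x y ? ?; rewrite rmorphD; apply: ideal_mulD.
  - by move=> x y Ix Jy; rewrite rmorphM; apply: ideal_mulM; [exists x|exists y].
apply: ideal_mul_sub.
- by exists 0; rewrite ?rmorph0 //; apply: ideal_mul0.
- move=> _ _ [x xP <-] [y yP <-].
  by exists (x + y); rewrite ?rmorphD //; apply: ideal_mulD.
- move=> _ _ [x xP <-] [y yP <-].
  by exists (x * y); rewrite ?rmorphM //; apply: ideal_mulM.
Qed.

Lemma ideal_gal_intring g : ideal_gal g intring = intring.
Proof.
apply/seteqP; split=> [_ [x Ox <-]|x Ox]; first exact: intring_gal.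
by exists (g^-1%g x); [apply: intring_gal | rewrite galKV].
Qed.

Lemma fractional_gal g I : fractional_ideal I -> fractional_ideal (ideal_gal g I).
Proof.
move=> [[I0 ID IM] [x Ix x0] [d [Od d0] dI]]; split.
- split; first by exists 0; rewrite ?rmorph0.
    move=> _ _ [y Iy <-] [z Iz <-].
    by exists (y + z); [apply: ID | rewrite rmorphD].
  move=> a _ Oa [y Iy <-]; exists (g^-1%g a * y); last by rewrite rmorphM /= galKV.
  by apply: IM => //; apply: intring_gal.
- by exists (g x); [exists x | rewrite fmorph_eq0].
- exists (g d); first by split; [apply: intring_gal | rewrite fmorph_eq0].
  by move=> _ [y Iy <-]; rewrite -rmorphM; apply/intring_gal/dI.
Qed.

Lemma invertible_gal g I : invertible_ideal I -> invertible_ideal (ideal_gal g I).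
Proof.
move=> [fI [J fJ IJ]]; split; first exact: fractional_gal.
exists (ideal_gal g J); first exact: fractional_gal.
by rewrite -ideal_galM IJ ideal_gal_intring.
Qed.

Definition ig_act (g : galK) (I : ideal_group) : ideal_group :=
  mk_ideal (invertible_gal g (ideal_setP I)).

Lemma ig_actD g : {morph ig_act g : I J / I + J}.
Proof. by move=> I J; apply: ideal_set_inj; apply: ideal_galM. Qed.

Lemma ig_act1 I : ig_act 1%g I = I.
Proof.
apply: ideal_set_inj; apply/seteqP; split=> [_ [x Ix <-]|x Ix].
  by rewrite gal_id.
by exists x; rewrite ?gal_id.
Qed.

Lemma ig_actM g h I : ig_act (g * h)%g I = ig_act h (ig_act g I).
Proof.
apply: ideal_set_inj; apply/seteqP; split=> [_ [x Ix <-]|_ [_ [x Ix <-] <-]].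
  by rewrite galKM; exists (g x) => //; exists x.
by exists x; rewrite ?galKM.
Qed.

Definition ideals : gmodule galK := GModule ig_actD ig_act1 ig_actM.

Definition totally_positive (x : K) : Prop := forall v : real_place, 0 < v x.

Definition principal_set : set ideals :=
  [set I | exists2 x, x != 0 & ideal_set I = principal_ideal x].

Definition principal_pos_set : set ideals :=
  [set I | exists2 x, x != 0 /\ totally_positive x
         & ideal_set I = principal_ideal x].

Lemma ideal_setB_principal (I J : ideals) x y : y != 0 ->
  ideal_set I = principal_ideal x -> ideal_set J = principal_ideal y ->
  ideal_set (I - J) = principal_ideal (x / y).
Proof.
move=> y0 Ix Jy; rewrite -principal_mul -Ix; congr ideal_mul.
have yi0 : y^-1 != 0 by rewrite invr_eq0.
rewrite -[LHS]/(ideal_inv (ideal_set J)) Jy.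
apply: ideal_invE; [exact: principal_fractional | exact: principal_fractional |].
by rewrite principal_mul mulfV // principal1.
Qed.

Lemma ideal_gal_principal (g : galK) x :
  ideal_gal g (principal_ideal x) = principal_ideal (g x).
Proof.
apply/seteqP; split=> [_ [_ [a Oa <-] <-]|_ [a Oa <-]].
  by rewrite rmorphM; exists (g a) => //; apply: intring_gal.
exists (x * g^-1%g a); last by rewrite rmorphM /= galKV.
by exists (g^-1%g a) => //; apply: intring_gal.
Qed.

Lemma principal_set0 : principal_set 0.
Proof. by exists 1; rewrite ?oner_neq0 // principal1. Qed.

Lemma principal_setB I J :
  principal_set I -> principal_set J -> principal_set (I - J).
Proof.
move=> [x x0 Ix] [y y0 Jy]; exists (x / y); first by rewrite mulf_neq0 ?invr_eq0.
exact: ideal_setB_principal.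
Qed.

Lemma principal_set_stable g I :
  principal_set I -> principal_set (gmod_act g I).
Proof.
move=> [x x0 Ix]; exists (g x); first by rewrite fmorph_eq0.
by rewrite -ideal_gal_principal -Ix.
Qed.

Lemma principal_pos_set0 : principal_pos_set 0.
Proof.
exists 1; last by rewrite principal1.
by split; [rewrite oner_neq0 | move=> v; rewrite rmorph1].
Qed.

Lemma principal_pos_setB I J :
  principal_pos_set I -> principal_pos_set J -> principal_pos_set (I - J).
Proof.
move=> [x [x0 px] Ix] [y [y0 py] Jy]; exists (x / y).
  split; first by rewrite mulf_neq0 ?invr_eq0.
  by move=> v; rewrite fmorph_div divr_gt0.
exact: ideal_setB_principal.
Qed.

Lemma principal_pos_set_stable g I :
  principal_pos_set I -> principal_pos_set (gmod_act g I).
Proof.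
move=> [x [x0 px] Ix]; exists (g x); last by rewrite -ideal_gal_principal -Ix.
by split; [rewrite fmorph_eq0 | move=> v; apply: (px (place_gal v g))].
Qed.

Definition class_group : gmodule galK :=
  gmod_quot (GSubmodule principal_set0 principal_setB principal_set_stable).

Definition narrow_class_group : gmodule galK :=
  gmod_quot (GSubmodule principal_pos_set0 principal_pos_setB
                        principal_pos_set_stable).

Section Ranks.
Variables (F : fieldType) (chi : character galK F).

Definition rk_char (M : gmodule galK) : nat :=
  multiplicity (char_module chi) (gmod_mod2 M).

Definition sgnrk_units : nat := multiplicity (char_module chi) sgn_units.

Definition rho_char : nat := rk_char class_group.

Definition kplus_char : int :=
  (rk_char narrow_class_group)%:Z - (rk_char class_group)%:Z.
End Ranks.
End NumberField.

(* Main.v *)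
Require Import Defs.
From HB Require Import structures.
From mathcomp Require Import all_boot all_order all_algebra all_fingroup.
From mathcomp Require Import all_solvable all_field generic_quotient ring_quotient.
From mathcomp Require Import polyrcf ring lra zify.
From mathcomp Require Import boolp classical_sets functions reals.

Set Implicit Arguments.
Unset Strict Implicit.
Unset Printing Implicit Defensive.

Import Order.TTheory GRing.Theory Num.Theory.
Local Open Scope ring_scope.

(** Write G for the Galois group, S for F_2(chi), V for V_infty(K) and U for
    sgn_infty(O_K^x). The chi-part M[chi] of a G-module M consists of the
    elements killed by the kernel of Z[G] -> S; a multiplicity m of S in M means
    |M[chi]| = |S|^m. As G has odd order, S is cut out by an idempotent e of
    F_2[G], so that M[chi] = eM when M has exponent 2.

    An odd-degree Galois field is totally real and G permutes its real places
    simply transitively, so V is F_2[G] and V[chi] is one copy of S; hence U[chi]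
    is 0 or V[chi]. By weak approximation the kernel of Cl^+ -> Cl is V/U.

    (a) If U[chi] = V[chi], then Cl^+/2 -> Cl/2 is injective on chi-parts, so
    k^+ <= 0.

    (b) Suppose Cl^+/2 has no chi-part and U[chi] = 0. Then e Cl^+ is contained in
    2 Cl^+, and a nonzero element of V[chi] gives a nonzero w in Cl^+ with 2w = 0
    and ew = w. Thus w = e^k w lies in 2^k Cl^+ for every k, which contradicts the
    finiteness of Cl^+. The latter is proved by Hurwitz's argument. *)

(** * Multiplicities and chi-parts *)

Section GroupSums.
Variable gT : finGroupType.
Implicit Types (M N : gmodule gT) (s t : seq gT).

(** A sequence, repetitions allowed, stands for an element of N[G]. Signs do not matter on
    chi-parts, which have exponent 2. *)
Definition seq_act M s (x : M) : M := \sum_(g <- s) gmod_act g x.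

Lemma gmod_act_sum M g I (r : seq I) (P : pred I) (F : I -> M) :
  gmod_act g (\sum_(i <- r | P i) F i) = \sum_(i <- r | P i) gmod_act g (F i).
Proof. exact: (big_morph _ (gmod_actD g) (gmod_act0 M g)). Qed.

Lemma gmod_actN M g (x : M) : gmod_act g (- x) = - gmod_act g x.
Proof. by rewrite -sub0r gmod_actB gmod_act0 sub0r. Qed.

Lemma seq_act_cat M s t (x : M) : seq_act (s ++ t) x = seq_act s x + seq_act t x.
Proof. exact: big_cat. Qed.

Lemma seq_act1 M g (x : M) : seq_act [:: g] x = gmod_act g x.
Proof. exact: big_seq1. Qed.

Lemma seq_actD M s : {morph @seq_act M s : x y / x + y}.
Proof.
by move=> x y; rewrite -big_split; apply: eq_bigr => g _; rewrite gmod_actD.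
Qed.

Lemma seq_act0 M s : seq_act s (0 : M) = 0.
Proof. by rewrite /seq_act big1 // => g _; rewrite gmod_act0. Qed.

Lemma seq_actN M s (x : M) : seq_act s (- x) = - seq_act s x.
Proof. by rewrite /seq_act -sumrN; apply: eq_bigr => g _; rewrite gmod_actN. Qed.

Lemma seq_actMn M s (x : M) k : seq_act s (x *+ k) = seq_act s x *+ k.
Proof. by elim: k => [|k IHk]; rewrite ?mulr0n ?seq_act0 // !mulrS seq_actD IHk. Qed.

Lemma seq_act_sum M s I (r : seq I) (P : pred I) (F : I -> M) :
  seq_act s (\sum_(i <- r | P i) F i) = \sum_(i <- r | P i) seq_act s (F i).
Proof. exact: (big_morph _ (@seq_actD M s) (seq_act0 M s)). Qed.

(** The factors are reversed because [gmod_act (g * h)] lets [g] act first. *)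
Definition seq_mul s t : seq gT := [seq (h * g)%g | g <- s, h <- t].

Lemma seq_actM M s t (x : M) : seq_act s (seq_act t x) = seq_act (seq_mul s t) x.
Proof.
rewrite /seq_act /seq_mul big_allpairs_dep; apply: eq_bigr => g _.
by rewrite gmod_act_sum; apply: eq_bigr => h _; rewrite gmod_actM.
Qed.

Lemma gmod_hom0 M N (f : M -> N) : gmod_hom f -> f 0 = 0.
Proof. by case=> fD _; apply: (addrI (f 0)); rewrite -fD !addr0. Qed.

Lemma gmod_homN M N (f : M -> N) x : gmod_hom f -> f (- x) = - f x.
Proof.
by move=> fP; apply: (addrI (f x)); have [fD _] := fP; rewrite -fD !subrr gmod_hom0.
Qed.

Lemma gmod_homB M N (f : M -> N) x y : gmod_hom f -> f (x - y) = f x - f y.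
Proof. by move=> fP; have [fD _] := fP; rewrite fD gmod_homN. Qed.

Lemma gmod_hom_seq_act M N (f : M -> N) s x :
  gmod_hom f -> f (seq_act s x) = seq_act s (f x).
Proof.
move=> fP; have [fD fA] := fP.
rewrite /seq_act (big_morph f fD (gmod_hom0 fP)).
by apply: eq_bigr => g _; rewrite fA.
Qed.

Lemma gmod_hom_comp M N (L : gmodule gT) (f : M -> N) (h : N -> L) :
  gmod_hom f -> gmod_hom h -> gmod_hom (h \o f).
Proof.
by move=> [fD fA] [hD hA]; split=> [x y|g x] /=; rewrite ?fD ?hD ?fA ?hA.
Qed.

Lemma gmod_hom_val M (P : gsubmodule M) :
  gmod_hom (fun x : gmod_sub P => val x : M).
Proof. by split. Qed.

Lemma gmod_isom_inv M N (f : M -> N) (h : N -> M) :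
  gmod_hom f -> cancel f h -> cancel h f -> gmod_hom h.
Proof.
move=> [fD fA] fK hK; split=> [x y|g x].
  by rewrite -{1}(hK x) -{1}(hK y) -fD fK.
by rewrite -{1}(hK x) -fA fK.
Qed.
End GroupSums.

(** * The chi-part and the idempotent that cuts it out *)

Section CharacterPart.
Variables (gT : finGroupType) (F : fieldType) (chi : character gT F).
Hypothesis F_char2 : 2%:R = 0 :> F.
Hypothesis odd_gT : odd #|gT|.
Implicit Types (M N : gmodule gT) (s t : seq gT).

Local Notation S := (char_module chi).

Lemma char2_addff (x : F) : x + x = 0.
Proof. by rewrite -mulr2n -mulr_natr F_char2 mulr0. Qed.

Lemma char2_oppf (x : F) : - x = x.
Proof. by apply/eqP; rewrite eq_sym -addr_eq0 char2_addff. Qed.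

Definition seq_char s : F := \sum_(g <- s) chi g.

Lemma seq_char_cat s t : seq_char (s ++ t) = seq_char s + seq_char t.
Proof. exact: big_cat. Qed.

Lemma seq_char1 g : seq_char [:: g] = chi g.
Proof. exact: big_seq1. Qed.

Lemma seq_char_mul s t : seq_char (seq_mul s t) = seq_char s * seq_char t.
Proof.
rewrite /seq_char /seq_mul big_allpairs_dep mulr_suml; apply: eq_bigr => g _.
by rewrite mulr_sumr; apply: eq_bigr => h _; rewrite char_M mulrC.
Qed.

(* The elements killed by the kernel of the evaluation map Z[G] -> F of chi. *)
Definition char_part M : set M :=
  [set x | forall s, seq_char s = 0 -> seq_act s x = 0].

Lemma char_part2 M (x : M) : char_part x -> x + x = 0.
Proof.
move=> /(_ [:: 1%g; 1%g]).
rewrite /seq_char /seq_act !big_cons !big_nil !gmod_act1 !addr0 char_1 char2_addff.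
exact.
Qed.

(** In characteristic 2 the concatenation [s ++ t] has character value zero, so it kills [x], and
    sums agree with differences in exponent 2. Hence G acts on the chi-part through F_2(chi). *)
Lemma char_part_eq M (x : M) s t :
  char_part x -> seq_char s = seq_char t -> seq_act s x = seq_act t x.
Proof.
move=> Px st; have := Px (s ++ t).
rewrite seq_char_cat seq_act_cat st char2_addff => /(_ erefl).
have tt0 : seq_act t x + seq_act t x = 0.
  by rewrite -seq_actD (char_part2 Px) seq_act0.
by move=> h; apply: (addIr (seq_act t x)); rewrite h tt0.
Qed.

Lemma char_part_seq_act M s (x : M) : char_part x -> char_part (seq_act s x).
Proof.
by move=> Px t t0; rewrite seq_actM Px // seq_char_mul t0 mul0r.
Qed.

Lemma char_part0 M : char_part (0 : M).
Proof. by move=> s _; rewrite seq_act0. Qed.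

Lemma char_partD M (x y : M) : char_part x -> char_part y -> char_part (x + y).
Proof. by move=> Px Py s s0; rewrite seq_actD Px // Py // addr0. Qed.

Lemma char_partB M (x y : M) : char_part x -> char_part y -> char_part (x - y).
Proof. by move=> Px Py s s0; rewrite seq_actD seq_actN Px // Py // subrr. Qed.

Lemma char_part_sum M I (r : seq I) (P : pred I) (f : I -> M) :
  (forall i, char_part (f i)) -> char_part (\sum_(i <- r | P i) f i).
Proof.
by move=> Pf; apply: big_ind => //; [exact: char_part0 | exact: char_partD].
Qed.

Lemma char_part_hom M N (f : M -> N) x : gmod_hom f -> char_part x -> char_part (f x).
Proof. by move=> fP Px s s0; rewrite -gmod_hom_seq_act // Px // gmod_hom0. Qed.

Lemma char_part_hom_inj M N (f : M -> N) x :
  gmod_hom f -> injective f -> char_part (f x) -> char_part x.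
Proof.
move=> fP finj Pfx s s0; apply: finj.
by rewrite gmod_hom_seq_act // Pfx // gmod_hom0.
Qed.

(** Euler's theorem for the odd number n = |G|: 2^phi(n) is 1 modulo n, and chi(g)^n = 1. *)
Lemma char_Frobenius_period_ex : exists d, (0 < d)%N && [forall g, chi g ^+ (2 ^ d) == chi g].
Proof.
set n := #|gT|; have n0 : (0 < n)%N by apply/card_gt0P; exists 1%g.
exists (totient n); rewrite totient_gt0 n0; apply/forallP => g; apply/eqP.
have chin : chi g ^+ n = 1.
  have chiX k : chi g ^+ k = chi (g ^+ k)%g.
    by elim: k => [|k IHk]; rewrite ?expr0 ?char_1 // exprS expgS char_M IHk.
  by rewrite chiX /n -cardsT expg_cardG ?inE // char_1.
have := @Euler_exp_totient 2 n; rewrite coprime2n => /(_ odd_gT).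
move=> e1; rewrite (divn_eq (2 ^ totient n) n) e1 exprD mulnC exprM chin expr1n mul1r.
(* For n = 1 the residue of 1 modulo n is 0, so the trivial group is treated apart. *)
case: (ltngtP n 1%N) n0 => // [n1 _|n1 _]; first by rewrite modn_small.
by move: chin; rewrite n1 modn1 expr1 expr0 => ->.
Qed.

(** This is the degree of F_2(chi) over F_2, as the order of Frobenius on the values of chi. *)
Definition char_period : nat := ex_minn char_Frobenius_period_ex.
Local Notation d := char_period.

Lemma char_period_gt0 : (0 < d)%N.
Proof. by rewrite /d; case: ex_minnP => m /andP[]. Qed.

Lemma char_periodP g : chi g ^+ (2 ^ d) = chi g.
Proof. by rewrite /d; case: ex_minnP => m /andP[_ /forallP/(_ g)/eqP]. Qed.

Lemma char_period_min i : (0 < i < d)%N -> exists g, chi g ^+ (2 ^ i) != chi g.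
Proof.
rewrite /d; case: ex_minnP => m _ min_m /andP[i0 im].
apply/existsP; rewrite -negb_forall; apply/negP => hi.
by have := min_m i; rewrite i0 hi leqNgt im => /(_ isT).
Qed.

Lemma Frobenius2D i (x y : F) : (x + y) ^+ (2 ^ i) = x ^+ (2 ^ i) + y ^+ (2 ^ i).
Proof.
elim: i => [|i IHi]; first by rewrite !expr1.
rewrite expnSr !exprM IHi sqrrD -mulr_natr F_char2 mulr0 addr0 //.
Qed.

Lemma Frobenius2_sum i I (r : seq I) (f : I -> F) :
  (\sum_(j <- r) f j) ^+ (2 ^ i) = \sum_(j <- r) f j ^+ (2 ^ i).
Proof.
apply: (big_morph (fun x => x ^+ (2 ^ i)) (Frobenius2D i)).
by rewrite expr0n expn_eq0.
Qed.

Lemma seq_char_period s : seq_char s ^+ (2 ^ d) = seq_char s.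
Proof. by rewrite Frobenius2_sum; apply: eq_bigr => g _; exact: char_periodP. Qed.

Lemma charV g : chi g^-1%g = (chi g)^-1.
Proof.
have gg : chi g^-1%g * chi g = 1 by rewrite -char_M mulVg char_1.
have g0 : chi g != 0.
  by apply/eqP => g0; move: gg; rewrite g0 mulr0 => /eqP; rewrite eq_sym oner_eq0.
by apply: (mulIf g0); rewrite gg mulVf.
Qed.

Lemma char_neq0 g : chi g != 0.
Proof.
apply/eqP => g0; have := char_1 chi; rewrite -(mulgV g) char_M g0 mul0r => /eqP.
by rewrite eq_sym oner_eq0.
Qed.

(* The coefficient Tr(chi(g)^-1) of g in the primitive idempotent of F_2[G]
   attached to chi, the trace being taken from F_2(chi) to F_2. *)
Definition idem_coef g : F := \sum_(i < d) (chi g^-1%g) ^+ (2 ^ i).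

(** Frobenius permutes the summands of the trace cyclically, so the trace is a root of X^2 = X. *)
Lemma idem_coef01 g : (idem_coef g == 0) || (idem_coef g == 1).
Proof.
have sq : idem_coef g ^+ 2 = idem_coef g.
  have := Frobenius2_sum 1 (enum 'I_d) (fun i => (chi g^-1%g) ^+ (2 ^ i)).
  rewrite expn1 !big_enum /= => ->; rewrite /idem_coef.
  rewrite -(prednK char_period_gt0) big_ord_recr [RHS]big_ord_recl [LHS]addrC /=.
  congr (_ + _).
    by rewrite -exprM -expnSr (prednK char_period_gt0) char_periodP expr1.
  by apply: eq_bigr => i _; rewrite -exprM -expnSr.
have : idem_coef g * (idem_coef g - 1) = 0 by rewrite mulrBr mulr1 -expr2 sq subrr.
by move/eqP; rewrite mulf_eq0 subr_eq0.
Qed.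

Lemma idem_coefE g : idem_coef g = (idem_coef g == 1)%:R.
Proof. by case/orP: (idem_coef01 g) => /eqP->; rewrite ?eqxx // eq_sym oner_eq0. Qed.

(** Multiplication by [h] permutes the summands and multiplies the sum by [psi h]. *)
Lemma sum_nontrivial_char (psi : gT -> F) h :
  {morph psi : x y / (x * y)%g >-> x * y} -> psi h != 1 -> \sum_g psi g = 0.
Proof.
move=> psiM h1; apply/eqP.
have : (psi h - 1) * \sum_g psi g = 0.
  rewrite mulrBl mul1r mulr_sumr [X in _ - X](reindex_inj (mulgI h)) /= -sumrB big1 // => g _.
  by rewrite -psiM subrr.
by move/eqP; rewrite mulf_eq0 subr_eq0 (negbTE h1).
Qed.

(** After exchanging the sums, i = 0 contributes |G| = 1 in [F]. For 0 < i < d the character chi^(1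
    - 2^i) is nontrivial by minimality of the period d, so its sum vanishes. *)
Lemma char_idem_coef_sum : \sum_g idem_coef g * chi g = 1.
Proof.
under eq_bigr do rewrite mulr_suml.
rewrite exchange_big /= -(prednK char_period_gt0) big_ord_recl [X in _ + X]big1.
  rewrite addr0; under eq_bigr do rewrite expr1 -char_M mulVg char_1.
  by rewrite sumr_const -(odd_double_half #|gT|) odd_gT mulrnDr -mul2n mulrnA F_char2
    mul0rn addr0.
move=> i _; have [|h hP] := @char_period_min i.+1.
  by have := ltn_ord i; rewrite -ltnS (prednK char_period_gt0).
apply: (@sum_nontrivial_char (fun g => chi g^-1%g ^+ (2 ^ i.+1) * chi g) h).
  by move=> x y; rewrite invMg !char_M exprMn [X in X * _]mulrC mulrACA.
apply: contra hP => /eqP; rewrite charV exprVn => h1.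
have := congr1 ( *%R (chi h ^+ (2 ^ i.+1))) h1.
by rewrite mulr1 mulrA divff ?mul1r ?expf_neq0 ?char_neq0 // => <-.
Qed.

(** The coefficients are 0 or 1, so the idempotent of F_2[G] is encoded by its support. *)
Definition idem : seq gT := [seq g <- enum gT | idem_coef g == 1].

Lemma seq_char_idem : seq_char idem = 1.
Proof.
rewrite /seq_char big_filter big_enum_cond /= -[RHS]char_idem_coef_sum big_mkcond /=.
apply: eq_bigr => g _; rewrite [idem_coef g in RHS]idem_coefE.
by case: ifP => _; rewrite ?mulr1n ?mul1r ?mulr0n ?mul0r.
Qed.

(** The coefficient of [h] in the product of [s] with the idempotent is, modulo 2, the trace of
    chi(h)^-1 chi(s), which is 0. *)
Lemma char_part_idem M (x : M) : x + x = 0 -> char_part (seq_act idem x).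
Proof.
move=> x2 s s0; rewrite /seq_act.
under eq_bigr => g _.
  rewrite gmod_act_sum big_filter big_enum_cond /= big_mkcond /=.
  rewrite (reindex_inj (mulIg g^-1%g)) /=.
  under eq_bigr => h _ do rewrite -gmod_actM mulgKV.
  over.
rewrite exchange_big big1 //= => h _.
rewrite -big_mkcond -big_filter big_const_seq count_predT iter_addr addr0 size_filter.
have -> : gmod_act h x *+ count (fun g => idem_coef (h * g^-1) == 1) s =
          gmod_act h x *+ odd (count (fun g => idem_coef (h * g^-1)%g == 1) s).
  rewrite -[in LHS](odd_double_half (count _ s)) mulrnDr -mul2n mulrnA.
  by rewrite mulr2n -gmod_actD x2 gmod_act0 mul0rn addr0.
suff /eqP : (count (fun g => idem_coef (h * g^-1)%g == 1) s)%:R = 0 :> F.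
  rewrite -[in X in X -> _](odd_double_half (count _ s)) natrD -mul2n natrM F_char2.
  by rewrite mul0r addr0; case: odd => //; rewrite oner_eq0.
rewrite -sum1_count natr_sum big_mkcond /=.
transitivity (\sum_(g <- s) idem_coef (h * g^-1)%g).
  by apply: eq_bigr => g _; rewrite [RHS]idem_coefE; case: ifP.
under eq_bigr => g _.
  rewrite /idem_coef.
  under eq_bigr => i _ do rewrite invMg invgK char_M exprMn mulrC.
  over.
rewrite exchange_big big1 //= => i _; rewrite -mulr_sumr -Frobenius2_sum.
by rewrite -/(seq_char s) s0 expr0n expn_eq0 mulr0.
Qed.

Lemma idem_act_id M (x : M) : char_part x -> seq_act idem x = x.
Proof.
move=> Px; rewrite -[RHS](gmod_act1 x) -seq_act1; apply: char_part_eq => //.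
by rewrite seq_char_idem seq_char1 char_1.
Qed.

(** The coefficients are constant on conjugacy classes, so conjugation permutes the support of the
    idempotent. *)
Lemma idem_act_comm M g (x : M) :
  seq_act idem (gmod_act g x) = gmod_act g (seq_act idem x).
Proof.
rewrite /seq_act gmod_act_sum !big_filter !big_enum_cond /=.
rewrite [RHS](reindex_inj (conjg_inj g^-1%g)) /=; apply: eq_big => [h|h _].
  congr (_ == _); apply: eq_bigr => i _; rewrite -conjVg /conjg !char_M mulrCA.
  by rewrite -[chi _ * chi _ in RHS]char_M mulVg char_1 mulr1.
by rewrite -!gmod_actM /conjg invgK mulgA mulgKV.
Qed.

(** The values of [seq_char] form a ring in which z^(2^d) = z. Nonzero elements thus have the
    inverse z^(2^d - 2), and the ring is already a field. *)
Lemma char_fieldP x : char_field chi x <-> exists s, seq_char s = x.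
Proof.
split; last first.
  move=> [s <-] E [E1 EB Ed] Echi.
  have E0 : 0 \in E by rewrite -(subrr 1) EB.
  elim: s => [|g s IHs]; first by rewrite /seq_char big_nil.
  by rewrite /seq_char big_cons -[X in _ + X]char2_oppf EB.
pose E : {pred F} := fun x => `[< exists s, seq_char s = x >].
have EP s : seq_char s \in E by apply/asboolP; exists s.
have EM y z : y \in E -> z \in E -> y * z \in E.
  by move=> /asboolP[s <-] /asboolP[t <-]; rewrite -seq_char_mul.
have E1 : 1 \in E by rewrite -(char_1 chi) -seq_char1.
have EX y k : y \in E -> y ^+ k \in E.
  by move=> Ey; elim: k => [|k IHk]; rewrite ?expr0 // exprS EM.
move=> /(_ E) EE; apply/asboolP/EE; last by move=> g; rewrite -seq_char1.
split=> // [_ _ /asboolP[s <-] /asboolP[t <-]|y z Ey].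
  by rewrite char2_oppf -seq_char_cat.
(* Division by zero yields 0, the value of the empty sequence. *)
have [->|z0 Ez] := eqVneq z 0.
  by rewrite invr0 mulr0 => _; have := EP [::]; rewrite /seq_char big_nil.
apply: EM => //; suff -> : z^-1 = z ^+ (2 ^ d - 2) by apply: EX.
have zd : z ^+ (2 ^ d) = z by move/asboolP: Ez => [s <-]; apply: seq_char_period.
have d2 : (2 <= 2 ^ d)%N by rewrite -{1}(expn1 2) leq_exp2l ?char_period_gt0.
apply: (mulIf (expf_neq0 2 z0)); rewrite -exprD subnK // zd.
by rewrite expr2 mulKf.
Qed.

Lemma char_modP (c : S) : exists s, seq_char s = val c.
Proof. exact/char_fieldP/asboolP/(valP c). Qed.

Definition char_lift (c : S) : seq gT := sval (cid (char_modP c)).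

Lemma char_liftK (c : S) : seq_char (char_lift c) = val c.
Proof. exact: svalP (cid (char_modP c)). Qed.

Lemma char_mod_subproof s :
  seq_char s \in gsub_mem (@GSubmodule gT (char_big_module chi) (char_field chi)
    (@char_field0 _ _ chi) (@char_fieldB _ _ chi) (@char_field_stable _ _ chi)).
Proof. by apply/asboolP/char_fieldP; exists s. Qed.

Definition char_mod_of s : S := exist _ (seq_char s) (char_mod_subproof s).

Lemma val_char_mod_of s : val (char_mod_of s) = seq_char s. Proof. by []. Qed.

Lemma char_mod_seq_act s (c : S) : val (seq_act s c) = seq_char s * val c :> F.
Proof.
rewrite /seq_act /seq_char (big_morph (fun x : S => val x : F) (id1 := 0) (op1 := +%R)) //.
by rewrite mulr_suml; apply: eq_bigr.
Qed.

Lemma char_mod_part (c : S) : char_part c.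
Proof. by move=> s s0; apply: val_inj; rewrite char_mod_seq_act s0 mul0r. Qed.

Definition char_one : S := char_mod_of [:: 1%g].

Lemma val_char_one : val char_one = 1 :> F.
Proof. by rewrite val_char_mod_of seq_char1 char_1. Qed.

Lemma char_one_neq0 : char_one != 0.
Proof.
by apply/eqP => /(congr1 val); rewrite val_char_one => /eqP; rewrite oner_eq0.
Qed.

(** Scalar multiplication of the F_2(chi)-vector space M[chi]; there the chosen lift is immaterial
    by [char_part_eq]. *)
Definition char_scale M (c : S) (x : M) : M := seq_act (char_lift c) x.

Lemma char_scaleE M s (x : M) :
  char_part x -> char_scale (char_mod_of s) x = seq_act s x.
Proof. by move=> Px; apply: char_part_eq => //; rewrite char_liftK. Qed.

Lemma char_scale_part M c (x : M) : char_part x -> char_part (char_scale c x).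
Proof. exact: char_part_seq_act. Qed.

Lemma char_scaleDl M (x : M) :
  char_part x -> {morph (char_scale (M := M))^~ x : c c' / c + c'}.
Proof.
move=> Px c c'; rewrite /char_scale -seq_act_cat; apply: char_part_eq => //.
by rewrite seq_char_cat !char_liftK.
Qed.

Lemma char_scale_act M g c (x : M) : char_part x ->
  char_scale (gmod_act g c) x = gmod_act g (char_scale c x).
Proof.
move=> Px; rewrite -[RHS]seq_act1 /char_scale seq_actM; apply: char_part_eq => //.
by rewrite seq_char_mul !char_liftK seq_char1.
Qed.

Lemma char_scale_hom M (x : M) :
  char_part x -> gmod_hom ((char_scale (M := M))^~ x).
Proof.
by move=> Px; split=> [|g c]; [exact: char_scaleDl | exact: char_scale_act].
Qed.

(** Sequences realise every element of the field F_2(chi), in particular the inverse of [c]. *)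
Lemma char_scale_inv M c (x : M) : char_part x -> c != 0 ->
  exists s, seq_act s (char_scale c x) = x.
Proof.
move=> Px c0; have vc0 : (val c : F) != 0 by [].
have [s sc] : exists s, seq_char s = (val c)^-1.
  apply/char_fieldP => E EP cE; have [E1 _ Ed] := EP.
  rewrite -[X in X \in E]mul1r; apply: Ed => //.
  by have /asboolP := valP c; apply.
exists s; rewrite seq_actM -[RHS]gmod_act1 -seq_act1; apply: char_part_eq => //.
by rewrite seq_char_mul char_liftK sc mulVf // seq_char1 char_1.
Qed.

Lemma char_scale_inj M (x : M) :
  char_part x -> x != 0 -> injective ((char_scale (M := M))^~ x).
Proof.
move=> Px x0 c c' /eqP; have sH := char_scale_hom Px.
rewrite -subr_eq0 -(gmod_homB _ _ sH) => /eqP e0.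
apply/eqP; rewrite -subr_eq0; apply: contraNT x0 => /(char_scale_inv Px)[s].
by rewrite e0 seq_act0 => <-.
Qed.

Lemma gmod_has_copy_inj N M (f : N -> M) :
  gmod_hom f -> injective f -> gmod_has_copy N M.
Proof.
move=> fP finj; have [fD fA] := fP.
have R0 : range f 0 by exists 0; rewrite ?gmod_hom0.
have RB x y : range f x -> range f y -> range f (x - y).
  by move=> [a _ <-] [b _ <-]; exists (a - b); rewrite ?gmod_homB.
have RA g x : range f x -> range f (gmod_act g x).
  by move=> [a _ <-]; exists (gmod_act g a); rewrite ?fA.
pose P := GSubmodule R0 RB RA; exists P.
have fR x : f x \in gsub_mem P by apply/asboolP; exists x.
exists (fun x => exist _ (f x) (fR x) : gmod_sub P).
  by split=> [x y|g x]; apply: val_inj; rewrite /= ?fD ?fA.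
have ex (y : gmod_sub P) : exists x, f x = val y.
  by have /asboolP[x _ <-] := valP y; exists x.
exists (fun y => sval (cid (ex y))) => [x|y].
  by apply: finj; apply: (svalP (cid (ex _))).
by apply: val_inj; apply: (svalP (cid (ex y))).
Qed.

(** A nonzero x in the chi-part spans the copy of S given by c -> c x. Conversely, the image of 1
    under an embedding of S is such an x. *)
Lemma char_has_copyP M : gmod_has_copy S M <-> exists2 x : M, x != 0 & char_part x.
Proof.
split=> [[P [f fP fbij]]|[x x0 Px]]; last first.
  exact: gmod_has_copy_inj (char_scale_hom Px) (char_scale_inj Px x0).
exists (val (f char_one)); last first.
  by apply: char_part_hom (gmod_hom_val P) _; apply: char_part_hom (char_mod_part _).
apply: contra char_one_neq0 => /eqP fc0; apply/eqP/(bij_inj fbij)/val_inj.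
by rewrite fc0 gmod_hom0.
Qed.

(** [phi] is a mere injection of sets, because ranks are compared through the cardinality |M[chi]| =
    |S|^m. *)
Definition char_dim M (m : nat) : Prop :=
  exists2 phi : {ffun 'I_m -> S} -> M, injective phi &
    forall x, char_part x <-> exists f, phi f = x.

(** The complement N has no chi-part by [char_has_copyP], so the chi-part of the direct sum is
    S^m. *)
Lemma is_multiplicity_char_dim M m : is_multiplicity S M m -> char_dim M m.
Proof.
move=> [N noS [f fP fbij]]; have [h fK hK] := fbij.
have hP := gmod_isom_inv fP fK hK.
exists (fun u => f (u, 0)) => [u u' /(bij_inj fbij)[]//|x].
split=> [Px|[u <-]]; last first.
  apply: (char_part_hom fP) => s s0.
  have -> : seq_act s ((u, 0) : gmod_sum (gmod_pow S m) N) = (seq_act s (u : gmod_pow S m), 0).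
    rewrite /seq_act; elim: s {s0} => [|g s IHs]; first by rewrite !big_nil.
    by rewrite !big_cons IHs /= /gsum_act /= gmod_act0; congr (_, _); rewrite addr0.
  congr (_, _); apply/ffunP => i; rewrite [RHS]ffunE.
  have -> : seq_act s (u : gmod_pow S m) i = seq_act s (u i).
    rewrite /seq_act; elim: s {s0} => [|g s IHs]; first by rewrite !big_nil ffunE.
    by rewrite !big_cons ffunE IHs ffunE.
  exact: char_mod_part.
have p2P : gmod_hom (fun y : gmod_sum (gmod_pow S m) N => y.2) by split.
have Py := char_part_hom p2P (char_part_hom hP Px).
exists (h x).1; rewrite -[RHS]hK; congr f; case: (h x) Py => a b /= Pb.
congr (_, _); apply/esym/eqP; apply: contra_notT noS => b0.
by apply/char_has_copyP; exists b.
Qed.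

Definition char_values : seq F := [seq \sum_(g in A) chi g | A : {set gT}].

(** Repeated elements cancel in pairs in characteristic 2, so subset sums exhaust F_2(chi), which is
    therefore finite. *)
Lemma seq_char_value s : seq_char s \in char_values.
Proof.
elim: s => [|g s /codomP[A sA]].
  by apply/codomP; exists finset.set0; rewrite /seq_char big_nil big_set0.
rewrite /seq_char big_cons -/(seq_char s) {}sA; apply/codomP.
have [gA|gA] := boolP (g \in A).
  exists (A :\ g)%SET; rewrite (big_setD1 g gA) /= addrA char2_addff add0r //.
by exists (g |: A)%SET; rewrite big_setU1.
Qed.

(** The injection of chi-parts gives |S|^m <= |S|^k, and |S| > 1. *)
Lemma char_dim_le M N m k (h : M -> N) : char_dim M m -> char_dim N k ->
  (forall x, char_part x -> char_part (h x)) ->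
  (forall x y, char_part x -> char_part y -> h x = h y -> x = y) -> (m <= k)%N.
Proof.
move=> [phi phi_inj phiP] [psi psi_inj psiP] hP hinj.
(* S is carried over to the finite type of its values, where cardinals can be compared. *)
pose T : finType := seq_sub char_values.
have vT (c : S) : val c \in char_values by rewrite -char_liftK seq_char_value.
pose toT (c : S) : T := SeqSub (vT c).
have exS (t : T) : exists c : S, val c = val t.
  have /codomP[A eA] := valP t; exists (char_mod_of (enum A)).
  by rewrite eA val_char_mod_of /seq_char big_enum.
pose toS (t : T) : S := sval (cid (exS t)).
have toTK : cancel toT toS by move=> c; apply: val_inj; apply: (svalP (cid (exS _))).
have toSK : cancel toS toT by move=> c; apply: val_inj; apply: (svalP (cid (exS _))).
have T2 : (1 < #|T|)%N.
  apply/card_gt1P; exists (toT 0), (toT char_one).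
  by split=> //; rewrite eq_sym (can_eq toTK) char_one_neq0.
have Pphi u : char_part (phi u) by apply/phiP; exists u.
have exU (u : {ffun 'I_m -> T}) : exists w, psi w = h (phi [ffun i => toS (u i)]).
  exact/psiP/hP/Pphi.
pose H u : {ffun 'I_k -> T} := [ffun i => toT (sval (cid (exU u)) i)].
have Hinj : injective H.
  move=> u u' /ffunP uu'.
  have e : sval (cid (exU u)) = sval (cid (exU u')).
    by apply/ffunP => i; have := uu' i; rewrite !ffunE => /(can_inj toTK).
  have := svalP (cid (exU u)); rewrite e (svalP (cid (exU u'))).
  move=> /hinj => /(_ (Pphi _) (Pphi _)) /phi_inj /ffunP uu.
  by apply/ffunP => i; have := uu i; rewrite !ffunE => /(can_inj toSK).
by have := leq_card _ Hinj; rewrite !card_ffun !card_ord leq_exp2l.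
Qed.

Lemma char_dim_gt0 M m : char_dim M m -> (0 < m)%N ->
  exists2 x : M, x != 0 & char_part x.
Proof.
move=> [phi phi_inj phiP] m0; pose u : {ffun 'I_m -> S} := [ffun=> char_one].
have [u0|u0] := eqVneq (phi u) 0; last by exists (phi u) => //; apply/phiP; exists u.
exists (phi 0); last by apply/phiP; exists 0.
rewrite -u0 (inj_eq phi_inj); apply/eqP => /ffunP/(_ (Ordinal m0)).
by rewrite !ffunE => /eqP; rewrite eq_sym (negbTE char_one_neq0).
Qed.

Lemma char_dim0 M (x : M) : char_dim M 0 -> char_part x -> x = 0.
Proof.
move=> [phi _ phiP] /phiP[u <-]; have /phiP[u' <-] := char_part0 M.
by congr phi; apply/ffunP; case.
Qed.

(** * Existence of multiplicities in finite modules of exponent 2 *)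

Section Existence.
Variables (M : gmodule gT) (T : finType) (code : M -> T).
Hypothesis code_inj : injective code.
Hypothesis M2 : forall x : M, x + x = 0.

Definition char_comb m (x : 'I_m -> M) (u : {ffun 'I_m -> S}) : M :=
  \sum_i char_scale (u i) (x i).

(** Linear independence over F_2(chi). *)
Definition char_free m (x : 'I_m -> M) : Prop :=
  (forall i, char_part (x i)) /\ injective (char_comb x).

Lemma char_comb_hom m (x : 'I_m -> M) : (forall i, char_part (x i)) ->
  gmod_hom (char_comb x : gmod_pow S m -> M).
Proof.
move=> Px; split=> [u w|g u]; rewrite /char_comb.
  by rewrite -big_split; apply: eq_bigr => i _; rewrite ffunE char_scaleDl.
by rewrite gmod_act_sum; apply: eq_bigr => i _; rewrite ffunE char_scale_act.
Qed.

(** The combinations with coefficients 0 and 1 are 2^m distinct elements of M. *)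
Lemma char_free_bound m (x : 'I_m -> M) : char_free x -> (m <= #|T|)%N.
Proof.
move=> [_ xinj].
pose H (b : {ffun 'I_m -> bool}) := code (char_comb x [ffun i => if b i then char_one else 0]).
have /leq_card : injective H.
  move=> b b' /code_inj/xinj/ffunP e; apply/ffunP => i; have := e i; rewrite !ffunE.
  have n0 := char_one_neq0.
  by case: (b i) (b' i) => [] [] // /eqP; rewrite ?[0 == _]eq_sym (negbTE n0).
rewrite card_ffun card_bool card_ord; apply: leq_trans.
exact/ltnW/ltn_expl.
Qed.

(** Exchange argument: adjoining an element outside the span would give a longer free family. *)
Lemma char_free_span m (x : 'I_m -> M) : char_free x ->
  (forall k (y : 'I_k -> M), char_free y -> (k <= m)%N) ->
  forall y, char_part y -> exists u, char_comb x u = y.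
Proof.
move=> [Px xinj] max_m y Py.
have [//|no] := pselect (exists u, char_comb x u = y).
pose x' (i : 'I_m.+1) := if unlift ord0 i is Some j then x j else y.
have x'0 : x' ord0 = y by rewrite /x' unlift_none.
have x'S i : x' (lift ord0 i) = x i by rewrite /x' liftK.
have Px' i : char_part (x' i) by rewrite /x'; case: unliftP.
suff /max_m : char_free x' by rewrite ltnn.
split=> // u u' /eqP; have xH' := char_comb_hom Px'; have xH := char_comb_hom Px.
rewrite -subr_eq0 -(gmod_homB _ _ xH') => /eqP.
set w := (u - u' : {ffun 'I_m.+1 -> S}).
rewrite /char_comb big_ord_recl x'0.
under eq_bigr do rewrite x'S.
(* If the coefficient of [y] vanishes, freeness of [x] makes the relation trivial; otherwise
   dividing by it puts [y] into the span. *)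
have [w0|w0] := eqVneq (w ord0) 0.
  rewrite w0 (gmod_hom0 (char_scale_hom Py)) add0r => e0.
  have : [ffun i => w (lift ord0 i)] = 0 :> {ffun 'I_m -> S}.
    apply: xinj; rewrite (gmod_hom0 xH) -[RHS]e0.
    by apply: eq_bigr => i _; rewrite ffunE.
  move=> /ffunP wS; apply/eqP; rewrite -subr_eq0; apply/eqP/ffunP => i.
  rewrite -/w [RHS]ffunE; case: (unliftP ord0 i) => [j ->|-> //].
  by have := wS j; rewrite !ffunE.
move=> /eqP; rewrite addr_eq0 => /eqP e0; case: no.
have [s <-] := char_scale_inv Py w0.
exists [ffun i => char_mod_of (seq_mul s (char_lift (w (lift ord0 i))))].
rewrite e0; have -> (z : M) : - z = z by apply/eqP; rewrite eq_sym -addr_eq0 M2.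
rewrite seq_act_sum; apply: eq_bigr => i _.
by rewrite ffunE char_scaleE // -seq_actM.
Qed.

(** Decomposition M = eM + ker e by the idempotent e: a maximal free family identifies the chi-part
    eM with S^m, and ker e is the complement. *)
Lemma is_multiplicity_ex : exists m, is_multiplicity S M m.
Proof.
pose P m := `[< exists x : 'I_m -> M, char_free x >].
have P0 : exists m, P m.
  exists 0%N; apply/asboolP; exists (fun=> 0); split; first by case.
  by move=> u u' _; apply/ffunP; case.
have Pb m : P m -> (m <= #|T|)%N by move=> /asboolP[x]; apply: char_free_bound.
case: (ex_maxnP P0 Pb) => m /asboolP[x xP] max_m; exists m.
have [Px xinj] := xP; have xH := char_comb_hom Px.
have span := char_free_span xP (fun k y yP => max_m k (asboolT (ex_intro _ y yP))).
have K0 : seq_act idem (0 : M) = 0 by rewrite seq_act0.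
have KB y z : seq_act idem y = 0 -> seq_act idem z = 0 -> seq_act idem (y - z) = 0 :> M.
  by move=> y0 z0; rewrite seq_actD seq_actN y0 z0 subrr.
have KA g y : seq_act idem y = 0 -> seq_act idem (gmod_act g y) = 0 :> M.
  by move=> y0; rewrite idem_act_comm y0 gmod_act0.
pose Q : gsubmodule M := @GSubmodule _ M [set y | seq_act idem y = 0] K0 KB KA.
have QP (y : gmod_sub Q) : seq_act idem (val y) = 0 by have /asboolP := valP y.
exists (gmod_sub Q).
  (* e fixes the chi-part and kills [Q], so [Q] has no chi-part. *)
  move=> /char_has_copyP[y y0 Py]; move/eqP: y0; apply; apply: val_inj.
  by rewrite -[LHS]idem_act_id ?QP //; apply: char_part_hom Py; apply: gmod_hom_val.
pose f (y : gmod_sum (gmod_pow S m) (gmod_sub Q)) : M := char_comb x y.1 + val y.2.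
have fP : gmod_hom f.
  have [xD xA] := xH; split=> [y z|g y]; rewrite /f /=; first by rewrite xD addrACA.
  by rewrite xA gmod_actD.
have idemx u : seq_act idem (char_comb x u) = char_comb x u.
  apply: idem_act_id; apply: char_part_sum => i; exact: char_scale_part.
have finj : injective f.
  move=> y z /eqP; rewrite -subr_eq0 -(gmod_homB _ _ fP) => /eqP.
  set w := y - z => fw.
  have w1 : char_comb x w.1 = 0.
    by rewrite -idemx -[RHS](seq_act0 _ idem) -fw /f seq_actD QP addr0.
  apply/eqP; rewrite -subr_eq0 -/w; apply/eqP; apply/pair_equal_spec; split.
    by apply: xinj; rewrite w1 (gmod_hom0 xH).
  by apply: val_inj; move: fw; rewrite /f w1 add0r.
have exf y : exists z, f z = y.
  have [u uy] := span _ (char_part_idem (M2 y)).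
  have Qy : y - seq_act idem y \in gsub_mem Q.
    apply/asboolP; rewrite /= seq_actD seq_actN [X in _ - X]idem_act_id ?subrr //.
    exact: char_part_idem.
  by exists (u, (exist (fun z => z \in gsub_mem Q) _ Qy : gsub_type Q)); rewrite /f uy /= addrC subrK.
exists f => //; exists (fun y => sval (cid (exf y))) => [z|y].
  by apply: finj; apply: (svalP (cid (exf _))).
exact: (svalP (cid (exf _))).
Qed.

Lemma multiplicity_char_dim : char_dim M (multiplicity S M).
Proof.
apply: is_multiplicity_char_dim; rewrite /multiplicity; have [m mP] := is_multiplicity_ex.
exact: (xgetPex 0%N (ex_intro _ m mP)).
Qed.
End Existence.
End CharacterPart.

(** * Real places and signs *)

Section Places.
Variables (R : realType) (K : splittingFieldType rat).
Local Notation galK := (gal_of {:K}%VS).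
Local Notation place := (real_place R K).
Local Notation sgn := (@sgninf R K).

Lemma galois_rat : galois 1 {:K}.
Proof.
rewrite /galois subvf normalFieldf andbT; apply/separableP => x _.
apply: pcharf0_separable => p; rewrite (fmorph_pchar (in_alg K)).
exact: pchar_num.
Qed.

Lemma mem_Gal_rat (g : galK) : g \in 'Gal({:K} / 1)%g.
Proof. by rewrite gal_kHom ?sub1v // k1AHom. Qed.

Lemma card_galK : #|{: galK}| = \dim {:K}.
Proof.
have := galois_dim galois_rat; rewrite dimv1 divn1 => ->.
by apply: eq_card => g; rewrite mem_Gal_rat.
Qed.

Lemma gal_fixed_rat (x : K) : (forall g : galK, g x = x) -> exists q : rat, x = q%:A.
Proof.
move=> fix_x; apply/vlineP; have /galois_fixedField <- := galois_rat.
by apply/fixedFieldP; rewrite ?memvf // => g _.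
Qed.

Definition theta : K := separable_generator 1 {:K}.

Lemma theta_adjoin : {:K}%VS = <<1; theta>>%VS.
Proof.
by apply: eq_adjoin_separable_generator; rewrite ?subvf //; case/and3P: galois_rat.
Qed.

Lemma theta_poly (x : K) : exists p : {poly rat}, x = (map_poly (in_alg K) p).[theta].
Proof. by apply/Fadjoin1_polyP; rewrite -theta_adjoin memvf. Qed.

Lemma theta_minPoly : exists2 p : {poly rat},
  map_poly (in_alg K) p = minPoly 1 theta & size p = (\dim {:K}).+1.
Proof.
have [p Dp] := polyOver1P (minPolyOver 1 theta).
exists p => //; rewrite -(size_map_poly (in_alg K)) -Dp size_minPoly.
by rewrite adjoin_degreeE -theta_adjoin dimv1 divn1.
Qed.

Lemma place_rat (v : place) q : v q%:A = ratr q.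
Proof. exact: (fmorph_eq_rat (v \o in_alg K)). Qed.

Lemma place_horner (v : place) (p : {poly rat}) x :
  v (map_poly (in_alg K) p).[x] = (map_poly ratr p).[v x].
Proof.
rewrite -horner_map -map_poly_comp; congr (_.[_]); apply: eq_map_poly => q /=.
exact: place_rat.
Qed.

Lemma place_theta_inj (v w : place) : v theta = w theta -> v = w.
Proof.
move=> vw; apply: real_place_eq => x; have [p ->] := theta_poly x.
by rewrite !place_horner vw.
Qed.

(** The minimal polynomial of [theta] has odd degree, hence a real root [r]; the place sends
    p(theta) to p(r). *)
Lemma real_place_ex : odd (\dim {:K}) -> exists v : place, True.
Proof.
move=> odd_dim; have [m Dm size_m] := theta_minPoly.
have [r rm] : {r : R | root (map_poly ratr m) r}.
  by apply: polyrcf.odd_poly_root; rewrite size_map_poly size_m /= odd_dim.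
pose P x := sval (cid (theta_poly x)).
have PE x : (map_poly (in_alg K) (P x)).[theta] = x by rewrite -(svalP (cid (theta_poly x))).
(* Well-definedness: polynomials that agree at [theta] differ by a multiple of the minimal
   polynomial. *)
have val_r (p q : {poly rat}) :
    (map_poly (in_alg K) p).[theta] = (map_poly (in_alg K) q).[theta] ->
  (map_poly ratr p).[r] = (map_poly ratr q).[r].
  move=> pq; apply/eqP; rewrite -subr_eq0 -hornerN -hornerD -rmorphB /= -/(root _ _).
  suff /dvdpP[s ->] : m %| (p - q) by rewrite rmorphM rootM rm orbT.
  rewrite -(dvdp_map (in_alg K)) Dm minPoly_dvdp ?alg_polyOver //.
  by rewrite /root rmorphB hornerD hornerN pq subrr.
pose f (x : K) : R := (map_poly ratr (P x)).[r].
have fB : zmod_morphism f.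
  move=> x y; rewrite /f -hornerN -hornerD -rmorphB; apply: val_r.
  by rewrite rmorphB hornerD hornerN !PE.
have fM : monoid_morphism f.
  split=> [|x y].
    transitivity ((map_poly ratr 1).[r]); last by rewrite rmorph1 hornerC.
    apply: val_r.
    by rewrite PE rmorph1 hornerC.
  by rewrite /f -hornerM -rmorphM; apply: val_r; rewrite rmorphM hornerM !PE.
by exists (HB.pack_for {rmorphism K -> R} f
  (GRing.isZmodMorphism.Build K R f fB) (GRing.isMonoidMorphism.Build K R f fM)).
Qed.

(** Both places send [theta] to roots of the same rational polynomial, whose roots are the
    conjugates v(g theta). *)
Lemma real_place_transitive (v w : place) : exists g : galK, w = place_gal v g.
Proof.
have /(galois_factors (sub1v _)) := galois_rat.
move=> /(_ theta (memvf _)) [r [_ _ Dm]]; have [m mE _] := theta_minPoly.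
have mapE (u : place) : map_poly u (minPoly 1 theta) = map_poly ratr m.
  by rewrite -mE -map_poly_comp; apply: eq_map_poly => q /=; apply: place_rat.
have : root (map_poly w (minPoly 1 theta)) (w theta) by rewrite fmorph_root root_minPoly.
rewrite mapE -(mapE v) Dm rmorph_prod /= big_map.
under eq_bigr do rewrite rmorphB /= map_polyX map_polyC /=.
rewrite -(big_map (fun g : galK => v (g theta)) xpredT (fun a => 'X - a%:P)).
rewrite root_prod_XsubC => /mapP[g _ wg]; exists g.
exact: place_theta_inj.
Qed.

Lemma place_gal_free (v : place) (g h : galK) : place_gal v g = place_gal v h -> g = h.
Proof.
move=> vgh; apply/eqP/gal_eqP => x _; apply: (fmorph_inj v).
exact: (congr1 (fun u : place => u x) vgh).
Qed.

Lemma place_galM (v : place) (g h : galK) :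
  place_gal (place_gal v h) g = place_gal v (g * h)%g.
Proof. by apply: real_place_eq => x; rewrite /place_gal /= galKM. Qed.

Lemma place_gal1 (v : place) : place_gal v 1%g = v.
Proof. by apply: real_place_eq => x; rewrite /place_gal /= gal_id. Qed.

Lemma isolating_rat (I : finType) (a : I -> R) (i : I) : injective a ->
  exists q1 q2 : rat, forall j, (ratr q1 < a j < ratr q2) = (j == i) /\
     (a j != ratr q1) /\ (a j != ratr q2).
Proof.
move=> a_inj.
have [e e0 eP] : exists2 e : R, 0 < e & forall j, j != i -> e <= `|a j - a i|.
  (* The default 1 is the value when [i] is the only index. *)
  exists (\big[Num.min/1]_(j | j != i) `|a j - a i|).
    elim/big_ind: _ => // [x y x0 y0|j ji]; first by rewrite lt_min x0.
    by rewrite normr_gt0 subr_eq0 (inj_eq a_inj).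
  by move=> j ji; rewrite (bigD1 j) //= ge_min lexx.
have [|q1 /[!in_itv]/= /andP[h1 h1']] := @rat_in_itvoo R (a i - e) (a i).
  by rewrite ltrBlDr ltrDl.
have [|q2 /[!in_itv]/= /andP[h2 h2']] := @rat_in_itvoo R (a i) (a i + e).
  by rewrite ltrDl.
exists q1, q2 => j; have [->|ji] := eqVneq j i.
  by rewrite h1' h2 (gt_eqF h1') (lt_eqF h2).
have := eP j ji; rewrite ler_normr lerBrDl opprB lerBrDl.
case/orP=> aj.
  have aj2 : ratr q2 < a j by apply: lt_le_trans h2' aj.
  have aj1 : ratr q1 < a j by apply: lt_trans aj2; apply: lt_trans h2.
  by rewrite aj1 [a j < _]ltNge (ltW aj2) (gt_eqF aj1) (gt_eqF aj2).
have aj1 : a j < ratr q1.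
  by apply: le_lt_trans h1; rewrite lerBrDr.
have aj2 : a j < ratr q2 by apply: lt_trans h2; apply: lt_trans h1'.
by rewrite [_ < a j]ltNge (ltW aj1) (lt_eqF aj1) (lt_eqF aj2).
Qed.

(** If the rational interval ]q1, q2[ isolates w(theta) among the conjugates, then (theta -
    q1)(theta - q2) is negative at [w] only. *)
Lemma sgninf_delta (v0 w : place) : exists2 x : K, x != 0 &
  forall v : place, sgn x v = `[< v = w >]%:R.
Proof.
have [g0 wE] := real_place_transitive v0 w.
have a_inj : injective (fun g : galK => v0 (g theta)).
  by move=> g h ghE; apply: (@place_gal_free v0); apply: place_theta_inj.
have [q1 [q2 qP]] := isolating_rat g0 a_inj.
have subE (v : place) q : v (theta - q%:A) = v theta - ratr q.
  by rewrite rmorphB place_rat.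
exists ((theta - q1%:A) * (theta - q2%:A)).
  rewrite -(fmorph_eq0 v0) rmorphM !subE mulf_eq0 !subr_eq0.
  by have [_ [n1 n2]] := qP 1%g; rewrite gal_id in n1 n2; rewrite negb_or n1 n2.
move=> v; have [g vE] := real_place_transitive v0 v.
have [e [n1 n2]] := qP g; congr (_%:R).
have -> : `[< v = w >] = (g == g0).
  by rewrite vE wE; apply/asboolP/eqP => [/place_gal_free|->].
have q12 : ratr q1 < ratr q2 :> R.
  by have [+ _] := qP g0; rewrite eqxx => /andP[]; apply: lt_trans.
rewrite -e rmorphM !subE vE /=; move: n1 n2.
case: (ltgtP (ratr q1) (v0 (g theta))) => //= h1 _;
  case: (ltgtP (v0 (g theta)) (ratr q2)) => //= h2 _.
- by rewrite pmulr_rlt0 ?subr_gt0 // subr_lt0 h2.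
- by rewrite pmulr_rlt0 ?subr_gt0 // subr_lt0 ltNge (ltW h2).
- by rewrite nmulr_rlt0 ?subr_lt0 // subr_gt0 ltNge (ltW h2).
- by have := lt_trans h2 (lt_trans h1 q12); rewrite ltxx.
Qed.

(** Weak approximation at the real places: elements negative at a single place are multiplied over
    the support of [f]. *)
Lemma sgninf_surj (v0 : place) (f : Vinf R K) : exists2 x : K, x != 0 & sgn x = f.
Proof.
pose D g := s2val (cid2 (sgninf_delta v0 (place_gal v0 g))).
have D0 g : D g != 0 by exact: (s2valP (cid2 (sgninf_delta v0 (place_gal v0 g)))).
have DE g v : sgn (D g) v = `[< v = place_gal v0 g >]%:R.
  exact: (s2valP' (cid2 (sgninf_delta v0 (place_gal v0 g))) v).
have prodE (s : seq galK) : \prod_(g <- s) D g != 0 /\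
    forall v, sgn (\prod_(g <- s) D g) v = \sum_(g <- s) sgn (D g) v.
  elim: s => [|g s [n0 IHs]].
    by rewrite !big_nil oner_eq0; split=> // v; rewrite big_nil sgninf1.
  rewrite !big_cons mulf_neq0 //; split=> // v.
  by rewrite sgninfM // big_cons -IHs.
pose s := [seq g <- enum {: galK} | f (place_gal v0 g) == 1].
have [n0 sE] := prodE s; exists (\prod_(g <- s) D g) => //.
apply/funext => v; have [h ->] := real_place_transitive v0 v.
rewrite sE big_filter big_enum_cond /= big_mkcond (bigD1 h) //= big1 => [|g gh].
  rewrite addr0 DE asboolT //.
  by case: (f (place_gal v0 h)) => [[|[|]]] //= i; apply: val_inj.
rewrite DE asboolF ?if_same // => /place_gal_free hg.
by rewrite hg eqxx in gh.
Qed.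

Lemma sgninf_eq_pos (x y : K) : x != 0 -> y != 0 -> sgn x = sgn y ->
  totally_positive R (x / y).
Proof.
move=> x0 y0 xy v; rewrite fmorph_div.
have := congr1 (fun f => f v) xy; rewrite /sgninf /=.
have vx : v x != 0 by rewrite fmorph_eq0.
have vy : v y != 0 by rewrite fmorph_eq0.
case: (ltgtP (v x) 0) vx => // hx _; case: (ltgtP (v y) 0) vy => // hy _ _.
  by rewrite nmulr_rgt0 ?invr_lt0.
by rewrite divr_gt0.
Qed.

Lemma totally_positive_sgninf (x : K) : totally_positive R x -> sgn x = 0.
Proof. by move=> xpos; apply/funext => v; rewrite /sgninf ltNge ltW. Qed.

Lemma sgninf_prod (s : seq galK) (x : K) : x != 0 ->
  \prod_(g <- s) g x != 0 /\ sgn (\prod_(g <- s) g x) = seq_act s (sgn x : Vinf R K).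
Proof.
move=> x0; rewrite /seq_act; elim: s => [|g s [n0 IHs]].
  by rewrite !big_nil oner_eq0 sgninf1.
have gx0 : g x != 0 by rewrite fmorph_eq0.
by rewrite !big_cons mulf_neq0 // sgninfM // IHs sgninf_gal.
Qed.

Lemma Vinf_addff (f : Vinf R K) : f + f = 0.
Proof.
apply/funext => v; rewrite -[LHS]/(f v + f v).
by case: (f v) => [[|[|]]] //= i; apply: val_inj.
Qed.

Lemma Vinf_seq_act (s : seq galK) (f : Vinf R K) v :
  seq_act s f v = \sum_(g <- s) f (place_gal v g).
Proof.
rewrite /seq_act; elim: s => [|g s IHs]; first by rewrite !big_nil.
by rewrite !big_cons -IHs.
Qed.

(** Evaluation along the orbit of [v0] embeds V in a finite type. *)
Definition Vinf_code (v0 : place) (f : Vinf R K) : {ffun galK -> 'F_2} :=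
  [ffun g => f (place_gal v0 g)].

Lemma Vinf_code_inj v0 : injective (Vinf_code v0).
Proof.
move=> f h /ffunP fh; apply/funext => v; have [g ->] := real_place_transitive v0 v.
by have := fh g; rewrite !ffunE.
Qed.

Definition Vinf_delta (v0 : place) : Vinf R K := fun v => `[< v = v0 >]%:R.

Lemma Vinf_cyclic v0 (f : Vinf R K) :
  exists s : seq galK, f = seq_act s (Vinf_delta v0).
Proof.
(* The element g moves the delta at v0 to the delta at v0 o g^-1, whence the inverse. *)
exists [seq g <- enum {: galK} | f (place_gal v0 g^-1%g) == 1].
apply/funext => v; have [h ->] := real_place_transitive v0 v.
rewrite Vinf_seq_act big_filter big_enum_cond /= big_mkcond (bigD1 h^-1%g) //= big1.
  rewrite addr0 /Vinf_delta place_galM mulVg place_gal1 asboolT // invgK.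
  by case: (f (place_gal v0 h)) => [[|[|]]] //= i; apply: val_inj.
move=> g gh; rewrite /Vinf_delta place_galM asboolF ?if_same //.
rewrite -{2}[v0]place_gal1 => /place_gal_free /(canRL (mulgK h)).
by rewrite mul1g => gE; rewrite gE eqxx in gh.
Qed.
End Places.

(** * The chi-part of V *)

Section SignPart.
Variables (R : realType) (K : splittingFieldType rat) (F : fieldType).
Local Notation galK := (gal_of {:K}%VS).
Variables (chi : character galK F) (v0 : real_place R K).
Hypothesis F_char2 : 2%:R = 0 :> F.
Hypothesis odd_galK : odd #|{: galK}|.
Local Notation idemK := (idem chi odd_galK).

Definition Vinf_gen : Vinf R K := seq_act idemK (Vinf_delta v0).

Lemma Vinf_gen_part : char_part chi Vinf_gen.
Proof. by apply: char_part_idem => //; apply: Vinf_addff. Qed.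

(** The value at v0 o g^-1 is the coefficient of g in e, and e is nonempty because chi(e) = 1. *)
Lemma Vinf_gen_neq0 : Vinf_gen != 0.
Proof.
have /hasP[g gE _] : has predT idemK.
  rewrite has_predT; have := seq_char_idem chi F_char2 odd_galK.
  case: idemK => //; rewrite /seq_char big_nil => /eqP.
  by rewrite eq_sym oner_eq0.
apply/eqP => /(congr1 (fun f => f (place_gal v0 g^-1%g))).
have uE : uniq idemK by rewrite filter_uniq ?enum_uniq.
rewrite /Vinf_gen Vinf_seq_act (bigD1_seq g gE uE) /= big1.
  by rewrite addr0 /Vinf_delta place_galM mulgV place_gal1 asboolT.
move=> h hg; rewrite /Vinf_delta place_galM asboolF //.
rewrite -{2}[v0]place_gal1 => /place_gal_free /(canRL (mulgK g^-1%g)).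
by rewrite mul1g invgK => hE; rewrite hE eqxx in hg.
Qed.

(** Here f = e f, and e commutes with the sequence that produces f from the delta. *)
Lemma Vinf_part_cyclic (f : Vinf R K) :
  char_part chi f -> exists s, f = seq_act s Vinf_gen.
Proof.
move=> Pf; have [s fE] := Vinf_cyclic v0 f; exists s.
rewrite -[LHS](idem_act_id F_char2 odd_galK Pf) [in LHS]fE.
rewrite [seq_act s _ in LHS]/seq_act seq_act_sum; apply: eq_bigr => g _.
exact: idem_act_comm.
Qed.

(** V[chi] is a line over F_2(chi): the scalar that takes the generator to [u] is nonzero, hence
    invertible. *)
Lemma Vinf_part_simple (u f : Vinf R K) : char_part chi u -> char_part chi f ->
  u != 0 -> exists s, f = seq_act s u.
Proof.
move=> Pu Pf u0; have [t uE] := Vinf_part_cyclic Pu; have [s fE] := Vinf_part_cyclic Pf.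
have sE := char_scaleE F_char2 odd_galK t Vinf_gen_part.
have c0 : char_mod_of chi F_char2 odd_galK t != 0.
  apply: contraNneq u0 => c0; rewrite uE -sE c0.
  exact/eqP/(gmod_hom0 (char_scale_hom F_char2 odd_galK Vinf_gen_part)).
have [r rE] := char_scale_inv F_char2 odd_galK Vinf_gen_part c0.
by exists (seq_mul s r); rewrite -seq_actM uE -sE rE.
Qed.

Lemma Vinf_char_dim : char_dim chi (Vinf R K) 1.
Proof.
exists (fun u => char_scale F_char2 odd_galK (u ord0) Vinf_gen).
  move=> u u' /(char_scale_inj Vinf_gen_part Vinf_gen_neq0) uu.
  by apply/ffunP => i; rewrite (ord1 i).
move=> f; split=> [/Vinf_part_cyclic[s ->]|[u <-]].
  exists [ffun=> char_mod_of chi F_char2 odd_galK s].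
  by rewrite ffunE char_scaleE //; apply: Vinf_gen_part.
by apply: char_scale_part => //; apply: Vinf_gen_part.
Qed.
End SignPart.

(** * Finiteness of the narrow class group *)

Section IntegerRing.
Variables (R : realType) (K : splittingFieldType rat).
Local Notation galK := (gal_of {:K}%VS).
Variable v0 : real_place R K.

Lemma intring_int (z : int) : @intring K z%:~R.
Proof. exact: integral_id. Qed.

Lemma intring_nat (k : nat) : @intring K k%:R.
Proof. by rewrite -[k%:R]/(k%:Z%:~R); apply: intring_int. Qed.

Lemma intringN (x : K) : intring x -> intring (- x).
Proof. by rewrite -mulN1r => Ox; apply: intringM => //; apply: (intring_int (-1)). Qed.

Lemma intringB (x y : K) : intring x -> intring y -> intring (x - y).
Proof. by move=> Ox /intringN; apply: intringD. Qed.

Lemma intring_sum I (r : seq I) (P : pred I) (F : I -> K) :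
  (forall i, P i -> intring (F i)) -> intring (\sum_(i <- r | P i) F i).
Proof. by move=> OF; apply: big_ind => //; [exact: intring0 | exact: intringD]. Qed.

Lemma intring_prod I (r : seq I) (P : pred I) (F : I -> K) :
  (forall i, P i -> intring (F i)) -> intring (\prod_(i <- r | P i) F i).
Proof. by move=> OF; apply: big_ind => //; [exact: intring1 | exact: intringM]. Qed.

Lemma intA (z : int) : z%:~R%:A = z%:~R :> K.
Proof. exact: (rmorph_int (in_alg K)). Qed.

(** The question is moved to [algC], where rational algebraic integers are known to be integers. *)
Lemma intring_rat (q : rat) : intring (q%:A : K) -> exists z : int, q = z%:~R.
Proof.
case=> p mon_p rp.
have {rp} rq : root (map_poly intr p) q.
  rewrite -(fmorph_root (in_alg K)) -map_poly_comp.
  by rewrite (eq_map_poly (g := intr)) // => a /=; rewrite intA.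
have /intrP[z qz] : (ratr q : algC) \in Num.int.
  apply: Cint_rat_Aint; first exact: Crat_rat.
  apply: (@root_monic_Aint (map_poly intr p)).
  - rewrite (eq_map_poly (g := ratr \o intr)) => [|a /=]; last by rewrite rmorph_int.
    by rewrite map_poly_comp fmorph_root.
  - by rewrite monic_map.
  - by apply/polyOverP => i; rewrite coef_map /= intr_int.
by exists z; apply: (fmorph_inj (@ratr algC)); rewrite [LHS]qz /= ratr_int.
Qed.

Lemma intring_fixed (x : K) : intring x -> (forall g : galK, g x = x) ->
  exists z : int, x = z%:~R.
Proof.
move=> Ox /gal_fixed_rat[q xq]; move: Ox; rewrite xq => /intring_rat[z ->].
by exists z; rewrite intA.
Qed.

Lemma intring_trace (x : K) : intring x ->
  exists z : int, \sum_(g : galK) v0 (g x) = z%:~R.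
Proof.
move=> Ox; have [||z xz] := @intring_fixed (\sum_(g : galK) g x).
- by apply: intring_sum => g _; apply: intring_gal.
- move=> h; rewrite rmorph_sum [RHS](reindex_inj (mulIg h)) /=.
  by apply: eq_bigr => g _; rewrite -galKM.
by exists z; rewrite -[RHS](rmorph_int v0) -xz rmorph_sum.
Qed.

(** The absolute value of the norm from K to Q, computed in R along the orbit of [v0]. *)
Definition real_norm (x : K) : R := \prod_(g : galK) `|v0 (g x)|.

Lemma real_normM x y : real_norm (x * y) = real_norm x * real_norm y.
Proof. by rewrite -big_split; apply: eq_bigr => g _; rewrite !rmorphM normrM. Qed.

Lemma gal_prod_int (x : K) : intring x -> exists z : int, \prod_(g : galK) g x = z%:~R.
Proof.
move=> Ox; apply: intring_fixed; first by apply: intring_prod => g _; apply: intring_gal.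
move=> h; rewrite rmorph_prod [RHS](reindex_inj (mulIg h)) /=.
by apply: eq_bigr => g _; rewrite -galKM.
Qed.

Lemma real_norm_nat (x : K) : intring x -> exists k : nat, real_norm x = k%:R.
Proof.
move=> /gal_prod_int[z xz]; exists `|z|%N.
by rewrite /real_norm -normr_prod -rmorph_prod xz rmorph_int natr_absz intr_norm.
Qed.

Lemma real_norm_gt0 (x : K) : x != 0 -> 0 < real_norm x.
Proof.
by move=> x0; apply: prodr_gt0 => g _; rewrite normr_gt0 !fmorph_eq0.
Qed.

(** The norm of a denominator d is a nonzero integer and a multiple of d in O_K; its sign is then
    removed. *)
Lemma nat_denominator (x : K) : exists2 k : nat, (0 < k)%N & intring (k%:R * x).
Proof.
have [d d0 [Od Odx]] := intring_denominator x; have [z dz] := gal_prod_int Od.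
have Ozx : intring (z%:~R * x).
  rewrite -dz (bigD1 1%g) //= gal_id mulrAC; apply: intringM => //.
  by apply: intring_prod => g _; apply: intring_gal.
have z0 : z != 0.
  apply/eqP => z0; move/eqP: dz; rewrite z0 /= => /prodf_eq0[g _].
  by rewrite fmorph_eq0 (negbTE d0).
case: z Ozx z0 {dz} => k Ozx z0; first by exists k; rewrite ?lt0n.
exists k.+1 => //; move: Ozx; rewrite NegzE rmorphN mulNr => /intringN.
by rewrite opprK.
Qed.

Lemma integral_span : exists n (b : 'I_n -> K), (forall i, intring (b i)) /\
  forall x, exists c : 'I_n -> rat, x = \sum_i c i *: b i.
Proof.
pose e := vbasis {:K}.
pose N (i : 'I_(\dim {:K})) := s2val (cid2 (nat_denominator e`_i)).
have N0 i : (0 < N i)%N by exact: (s2valP (cid2 (nat_denominator e`_i))).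
have ON i : intring ((N i)%:R * e`_i) by exact: (s2valP' (cid2 (nat_denominator e`_i))).
exists (\dim {:K}), (fun i => (N i)%:R * e`_i); split=> // x.
exists (fun i => coord e i x / (N i)%:R).
rewrite [LHS](coord_vbasis (memvf x)); apply: eq_bigr => i _.
rewrite -[_%:R * _]/(_ * e`_i) mulr_natl -scaler_nat scalerA mulfVK //.
by rewrite pnatr_eq0 -lt0n.
Qed.

Lemma place_galZ (g : galK) (q : rat) (x : K) : v0 (g (q *: x)) = ratr q * v0 (g x).
Proof. by rewrite linearZ /= -mulr_algl rmorphM place_rat. Qed.

Lemma conjugate_bound n (b : 'I_n -> K) :
  exists B : nat, forall (g : galK) i, `|v0 (g (b i))| <= B%:R.
Proof.
set S : R := \sum_(g : galK) \sum_i `|v0 (g (b i))|.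
have S0 : 0 <= S by do 2!(apply: sumr_ge0 => ? _).
exists (Num.bound S) => g i; apply: le_trans (ltW (archi_boundP S0)).
rewrite /S (bigD1 g) //= (bigD1 i) //= -addrA lerDl addr_ge0 ?sumr_ge0 //.
by move=> h _; apply: sumr_ge0.
Qed.

Lemma comb_bound n (b : 'I_n -> K) (B : nat) (c : 'I_n -> rat) (e : R) :
  (forall (g : galK) i, `|v0 (g (b i))| <= B%:R) -> 0 <= e ->
  (forall i, `|ratr (c i)| <= e) ->
  forall g : galK, `|v0 (g (\sum_i c i *: b i))| <= n%:R * (e * B%:R).
Proof.
move=> bB e0 ce g; rewrite !rmorph_sum; apply: le_trans (ler_norm_sum _ _ _) _.
rewrite mulr_natl -[n in _ *+ n]card_ord -sumr_const; apply: ler_sum => i _.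
by rewrite place_galZ normrM ler_pM.
Qed.

Lemma intring_scale_int (z : int) (x : K) : intring x -> intring (z%:~R *: x).
Proof.
by move=> Ox; rewrite -mulr_algl intA; apply: intringM => //; apply: intring_int.
Qed.

(* Dirichlet's pigeonhole principle on the fractional parts of the coordinates. *)
Lemma integral_approximation : exists2 M : nat, (0 < M)%N & forall x : K,
  exists2 t : nat, (0 < t <= M)%N &
  exists2 w : K, intring w & forall g : galK, `|v0 (g (t%:R * x - w))| < 1.
Proof.
have [n [b [Ob span]]] := integral_span; have [B bB] := conjugate_bound b.
(* As k > n B, coordinates of size at most 1/k give conjugates of size at most n B / k < 1. *)
pose k := (n * B).+1; exists (k ^ n)%N; first by rewrite expn_gt0.
move=> x; have [c xE] := span x.
pose y (t : 'I_(k ^ n).+1) i : rat := t%:R * c i.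
pose fr t i : rat := y t i - (Num.floor (y t i))%:~R.
(* The k^n + 1 multiples t x, for t from 0 to k^n, are distributed over k^n boxes of side 1/k. *)
pose box t : {ffun 'I_n -> 'I_k} := [ffun i => inord `|Num.floor (k%:R * fr t i)|].
have fr01 t i : 0 <= fr t i < 1.
  by have := floor_itv (y t i); rewrite /fr intrD; lra.
have boxE t i : (box t i)%:R <= k%:R * fr t i < (box t i).+1%:R.
  have /andP[f0 f1] := fr01 t i; rewrite ffunE.
  have k0 : (0 : rat) < k%:R by rewrite ltr0n.
  set z := Num.floor _.
  have z0 : 0 <= z by rewrite floor_ge0 mulr_ge0 // ltW.
  have zk : (`|z| < k)%N.
    have : z%:~R < k%:R :> rat.
      by apply: le_lt_trans (floor_le _) _; rewrite -[ltRHS]mulr1 ltr_pM2l.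
    by rewrite -[k%:R]/(k%:~R) ltr_int -{1}(gez0_abs z0).
  by rewrite inordK //= -natr1 natr_absz (ger0_norm z0) -(intrD _ z 1) floor_itv.
have /injectivePn[t1 [t2 t12 box12]] : ~~ injectiveb box.
  apply/negP => /injectiveP/leq_card; rewrite card_ffun !card_ord.
  by rewrite ltnn.
wlog lt12 : t1 t2 t12 box12 / (t1 < t2)%N.
  move=> H; case: (ltngtP t1 t2) => [|lt21|/val_inj e]; first exact: H t12 box12.
    by apply: H lt21; rewrite 1?eq_sym.
  by rewrite e eqxx in t12.
exists (t2 - t1)%N; first by rewrite subn_gt0 lt12 (leq_trans (leq_subr _ _)) // -ltnS.
pose u i := Num.floor (y t2 i) - Num.floor (y t1 i).
exists (\sum_i (u i)%:~R *: b i).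
  by apply: intring_sum => i _; apply: intring_scale_int.
move=> g; pose dl i := fr t2 i - fr t1 i.
have -> : (t2 - t1)%:R * x - \sum_i (u i)%:~R *: b i = \sum_i dl i *: b i.
  rewrite {1}xE mulr_sumr -sumrB; apply: eq_bigr => i _.
  rewrite mulr_natl -scaler_nat scalerA -scalerBl; congr (_ *: _).
  rewrite /dl /fr /u /y natrB 1?ltnW // mulrBl rmorphB /=.
  by lra.
have dlP i : `|ratr (dl i)| <= k%:R^-1 :> R.
  rewrite -ratr_norm -(ratr_nat R k) -fmorphV ler_rat.
  have := boxE t1 i; have := boxE t2 i; rewrite box12 /dl => /andP[h1 h2] /andP[h3 h4].
  have k0 : (0 : rat) < k%:R by rewrite ltr0n.
  rewrite -(ler_pM2l k0) divff ?gt_eqF // -{1}(gtr0_norm k0) -normrM mulrBr.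
  move: (k%:R * fr t1 i) (k%:R * fr t2 i) h1 h2 h3 h4 => r1 r2.
  by rewrite ler_norml -!natr1; move: (nat_of_ord _)%:R => a; lra.
have k0 : (0 : R) < k%:R by rewrite ltr0n.
apply: le_lt_trans (comb_bound bB _ dlP g) _; first by rewrite invr_ge0 ltW.
by rewrite mulrCA ltr_pdivrMl // mulr1 -natrM ltr_nat.
Qed.

Lemma real_norm_lt1 (x : K) : (forall g : galK, `|v0 (g x)| < 1) -> real_norm x < 1.
Proof.
move=> x1; rewrite /real_norm (bigD1 1%g) //=; apply: le_lt_trans (x1 1%g).
rewrite -[leRHS]mulr1 ler_wpM2l // prodr_ile1 // => g _.
by rewrite normr_ge0 ltW.
Qed.

(** Let b be nonzero of least norm in I. Some t <= M brings t a / b within distance 1 of an integer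
    w at every place, so t a - w b has smaller norm than b and vanishes. Thus m = M! clears every
    quotient a / b. *)
Lemma fractional_reduction : exists2 m : nat, (0 < m)%N &
  forall I : set K, fractional_ideal I ->
  exists2 b : K, I b /\ b != 0 & forall a, I a -> intring (m%:R * a / b).
Proof.
have [M M0 approx] := integral_approximation; exists (M`!)%N; first exact: fact_gt0.
move=> I [[I0 ID IM] [x Ix x0] [d [Od d0] dI]].
have norm_d a : I a -> exists k : nat, real_norm (d * a) = k%:R.
  by move=> Ia; apply/real_norm_nat/dI.
(* The factor [d] makes the norms natural numbers, so that a least one exists. *)
pose P k := `[< exists2 b, I b /\ b != 0 & real_norm (d * b) = k%:R >].
have exP : exists k, P k.
  by have [k kE] := norm_d x Ix; exists k; apply/asboolP; exists x.
case: (ex_minnP exP) => k /asboolP[b [Ib b0] bk] min_k; exists b => // a Ia.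
have [t /andP[t0 tM] [w Ow small]] := approx (a / b).
have Ir : I (t%:R * a - w * b).
  apply: ID; first by apply: IM => //; apply: intring_nat.
  by rewrite -mulNr; apply: IM => //; apply: intringN.
have rE : t%:R * a - w * b = (t%:R * (a / b) - w) * b.
  by rewrite mulrBl -!mulrA mulVf // mulr1.
have [r0|r0] := eqVneq (t%:R * a - w * b) 0; last first.
  have [j jE] := norm_d _ Ir.
  have : (k <= j)%N by apply: min_k; apply/asboolP; exists (t%:R * a - w * b).
  rewrite leqNgt -(ltr_nat R) -jE -bk rE => /negP[].
  rewrite [d * (_ * b)]mulrCA [ltLHS]real_normM gtr_pMl ?real_norm_lt1 //.
  by rewrite real_norm_gt0 // mulf_neq0.
have t_nz : t%:R != 0 :> K.
  by rewrite -(fmorph_eq0 v0) rmorph_nat pnatr_eq0 -lt0n.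
have abE : a / b = w / t%:R.
  apply: (mulIf t_nz); rewrite mulfVK //; apply: (mulIf b0).
  by rewrite mulrAC mulfVK // mulrC; apply/eqP; rewrite -subr_eq0 r0.
have /dvdnP[q ->] : (t %| M`!)%N by apply: dvdn_fact; rewrite t0.
rewrite -mulrA abE natrM -mulrA [t%:R * _]mulrCA mulfV // mulr1.
by apply: intringM => //; apply: intring_nat.
Qed.

Definition bounded_conj (B : nat) (x : K) : Prop :=
  forall g : galK, `|v0 (g x)| <= B%:R.

(** The rational coordinates on an integral spanning family are reduced modulo m. *)
Lemma bounded_residue (m : nat) : (0 < m)%N -> exists B : nat, forall x : K,
  intring x -> exists2 y, intring y & intring (x - m%:R * y) /\ bounded_conj B (x - m%:R * y).
Proof.
move=> m0; have [n [b [Ob span]]] := integral_span; have [B bB] := conjugate_bound b.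
exists (n * (m * B))%N => x Ox; have [c xE] := span x.
pose z i := Num.floor (c i / m%:R).
have Oz : intring (\sum_i (z i)%:~R *: b i).
  by apply: intring_sum => i _; apply: intring_scale_int.
exists (\sum_i (z i)%:~R *: b i) => //; split.
  by apply: intringB => //; apply: intringM => //; apply: intring_nat.
have m0' : (0 : rat) < m%:R by rewrite ltr0n.
have -> : x - m%:R * (\sum_i (z i)%:~R *: b i) = \sum_i (c i - m%:R * (z i)%:~R) *: b i.
  rewrite xE mulr_sumr -sumrB; apply: eq_bigr => i _.
  by rewrite mulr_natl -scaler_nat scalerA -scalerBl.
move=> g; rewrite !natrM; apply: comb_bound => // i.
rewrite -ratr_norm -(ratr_nat R m) ler_rat.
have := floor_itv (c i / m%:R); rewrite -/(z i) intrD ler_pdivlMr // ltr_pdivrMr //.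
by rewrite ler_norml mulrDl mul1r mulrC; lra.
Qed.

(** A nonzero x pairs with x^-1 to the trace |G| of 1, which is nonzero. *)
Lemma trace_nondegenerate n (b : 'I_n -> K) (x : K) :
  (forall y, exists c : 'I_n -> rat, y = \sum_i c i *: b i) ->
  (forall i, \sum_(g : galK) v0 (g (x * b i)) = 0) -> x = 0.
Proof.
move=> span tr0; apply/eqP; apply: contraT => x0; have [c cE] := span x^-1.
have : \sum_(g : galK) v0 (g (x * x^-1)) = 0.
  rewrite cE mulr_sumr.
  under eq_bigr => g _.
    rewrite !rmorph_sum /=.
    under eq_bigr => i _ do rewrite -scalerAr place_galZ.
    over.
  by rewrite exchange_big big1 //= => i _; rewrite -mulr_sumr tr0 mulr0.
rewrite mulfV //; under eq_bigr do rewrite !rmorph1.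
rewrite sumr_const => /eqP; rewrite pnatr_eq0 => /eqP/card0_eq/(_ 1%g).
by rewrite inE.
Qed.

(** By nondegeneracy x is determined by the traces Tr(x b_i), which are integers of absolute value
    at most C. *)
Lemma bounded_integers_finite (B : nat) : exists (T : finType) (c : K -> T),
  forall x y, intring x -> intring y -> bounded_conj B x -> bounded_conj B y ->
  c x = c y -> x = y.
Proof.
have [n [b [Ob span]]] := integral_span; have [D bD] := conjugate_bound b.
pose C := (#|{: galK}| * (B * D))%N.
pose tr x i : R := \sum_(g : galK) v0 (g (x * b i)).
pose z x i : int := Num.floor (tr x i).
(* The shift by C puts the traces between 0 and 2C, where neither the absolute value nor [inord]
   loses information. *)
exists {ffun 'I_n -> 'I_(C + C).+1}, (fun x => [ffun i => inord `|z x i + C%:Z|]).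
have zE x i : intring x -> tr x i = (z x i)%:~R.
  move=> Ox; have [u uE] := intring_trace (intringM Ox (Ob i)).
  by rewrite /z /tr uE intrKfloor.
have zC x i : intring x -> bounded_conj B x -> - C%:Z <= z x i <= C%:Z.
  move=> Ox xB; rewrite -ler_norml -(ler_int R) intr_norm -zE //.
  apply: le_trans (ler_norm_sum _ _ _) _.
  have -> : C%:Z%:~R = #|{: galK}|%:R * (B%:R * D%:R) :> R by rewrite -!natrM.
  rewrite mulr_natl -sumr_const; apply: ler_sum => g _.
  rewrite !rmorphM normrM; exact: ler_pM (normr_ge0 _) (normr_ge0 _) (xB g) (bD g i).
move=> x y Ox Oy xB yB /ffunP exy; apply/eqP; rewrite -subr_eq0; apply/eqP.
apply: (trace_nondegenerate span) => i.
have := exy i; rewrite !ffunE => /(congr1 val).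
have := zC x i Ox xB; have := zC y i Oy yB => /andP[y1 y2] /andP[x1 x2].
rewrite /= !inordK; [|lia..] => zxy.
have {}zxy : z x i = z y i by lia.
rewrite (eq_bigr (fun g : galK => v0 (g (x * b i)) - v0 (g (y * b i)))) => [|g _].
  by rewrite sumrB -!/(tr _ i) !zE // zxy subrr.
by rewrite mulrBl !rmorphB.
Qed.

(** The scaled ideal (m/b) I lies in O_K and contains m O_K, so its elements with bounded conjugates
    determine it. Recording the signs of b as well makes the ratio of two ideals with equal codes
    totally positive. *)
Lemma fractional_finite : exists (T : finType) (c : set K -> T), forall I J,
  fractional_ideal I -> fractional_ideal J -> c I = c J ->
  exists2 u : K, u != 0 /\ totally_positive R u & I = [set u * a | a in J]%classic.
Proof.
have [m m0 red] := fractional_reduction; have [B res] := bounded_residue m0.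
have [T [c c_inj]] := bounded_integers_finite B.
have m_nz : m%:R != 0 :> K.
  by rewrite -(fmorph_eq0 v0) rmorph_nat pnatr_eq0 -lt0n.
have exb (I : set K) : exists b : K, fractional_ideal I ->
    [/\ I b, b != 0 & forall a, I a -> intring (m%:R * a / b)].
  have [fI|nfI] := pselect (fractional_ideal I); last by exists 0.
  by have [b [Ib b0] bP] := red I fI; exists b.
pose b I := sval (cid (exb I)).
have bP I : fractional_ideal I ->
    [/\ I (b I), b I != 0 & forall a, I a -> intring (m%:R * a / b I)].
  exact: svalP (cid (exb I)).
pose L (I : set K) : set K := [set x : K | exists2 a, I a & x = m%:R * a / b I]%classic.
exists ({set T} * {ffun galK -> 'F_2})%type, (fun I =>
  ([set t | `[< exists2 x, L I x /\ bounded_conj B x & c x = t >]],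
   Vinf_code v0 (@sgninf R K (b I)))).
have L_sub I J : fractional_ideal I -> fractional_ideal J ->
    [set t | `[< exists2 x, L I x /\ bounded_conj B x & c x = t >]] =
    [set t | `[< exists2 x, L J x /\ bounded_conj B x & c x = t >]] ->
  forall x, L I x -> L J x.
  move=> fI fJ /setP cIJ x LIx.
  have [Ib bI0 bI] := bP I fI; have [Jb bJ0 bJ] := bP J fJ.
  have [[I0 ID IM] _ _] := fI; have [[J0 JD JM] _ _] := fJ.
  have OL y : L I y -> intring y by move=> [a Ia ->]; apply: bI.
  have OLJ y : L J y -> intring y by move=> [a Ja ->]; apply: bJ.
  have [y Oy [Or Br]] := res x (OL x LIx).
  (* Subtracting m y stays inside [L I] because [b I] lies in [I]. *)
  have LIr : L I (x - m%:R * y).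
    have [a Ia xE] := LIx; exists (a + - y * b I).
      by apply: ID => //; apply: IM => //; apply: intringN.
    by rewrite xE; field.
  have := cIJ (c (x - m%:R * y)); rewrite !inE.
  rewrite asboolT; last by exists (x - m%:R * y).
  move=> /esym/asboolP[x' [LJx' Bx'] cx'].
  have {cx'}x'E : x' = x - m%:R * y by apply: c_inj => //; apply: OLJ.
  have [a Ja x'E'] := LJx'; exists (a + y * b J).
    by apply: JD => //; apply: JM.
  by rewrite -[x](subrK (m%:R * y)) -x'E x'E'; field.
move=> I J fI fJ [cIJ /Vinf_code_inj sIJ].
have [Ib bI0 bI] := bP I fI; have [Jb bJ0 bJ] := bP J fJ.
exists (b I / b J).
  by split; [rewrite mulf_neq0 ?invr_eq0 | apply: sgninf_eq_pos].
have LE H x : b H != 0 -> (L H (m%:R * x / b H) <-> H x).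
  move=> bH0; split=> [[a Ha e]|Hx]; last by exists x.
  suff -> : x = a by [].
  by apply: (mulfI m_nz); apply: (mulIf (invr_neq0 bH0)).
apply/seteqP; split=> x.
  move=> /(LE I x bI0)/(L_sub _ _ fI fJ cIJ)[a Ja e]; exists a => //.
  apply: (mulfI m_nz); apply: (mulIf (invr_neq0 bI0)).
  by rewrite e; field; rewrite bI0 bJ0.
move=> [a Ja <-]; apply/(LE I _ bI0).
have /(L_sub _ _ fJ fI (esym cIJ)) : L J (m%:R * a / b J) by apply/LE.
by congr (L I _); field; rewrite bI0 bJ0.
Qed.

Lemma narrow_class_finite : exists (T : finType)
  (c : narrow_class_group R K -> T), injective c.
Proof.
have [T [c cP]] := fractional_finite.
exists T, (fun x => c (ideal_set (repr x))) => x y cxy.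
have fr (z : ideals K) : fractional_ideal (ideal_set z) by have [] := ideal_setP z.
have [u [u0 upos] uE] := cP _ _ (fr _) (fr _) cxy.
rewrite -[x]reprK -[y]reprK; apply/eqP; rewrite -Quotient.idealrBE.
apply/asboolP; exists u => //.
have I1 : repr x = (mk_ideal (principal_invertible u0) : ideals K) + repr y.
  apply: ideal_set_inj; rewrite uE; apply/seteqP; split=> [_ [a Ia <-]|].
    by apply: ideal_mulM => //; exists 1; [exact: intring1 | rewrite mulr1].
  have [[J0 JD JM] _ _] := fr (repr y).
  apply: ideal_mul_sub => /=.
  - by exists 0; rewrite ?mulr0.
  - by move=> _ _ [a Ja <-] [b Jb <-]; exists (a + b); [apply: JD | rewrite mulrDr].
  - by move=> _ a [d Od <-] Ja; exists (d * a); [apply: JM | rewrite mulrA].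
by rewrite I1 addrK.
Qed.
End IntegerRing.

(** * The chi-parts of the class groups *)

Section Quotients.
Variable gT : finGroupType.
Implicit Type M : gmodule gT.

Definition gpi M (P : gsubmodule M) (x : M) : gmod_quot P :=
  (\pi_({ideal_quot gsub_mem P})%qT x)%qT.

Lemma gpi_hom M (P : gsubmodule M) : gmod_hom (gpi P).
Proof.
split=> [x y|g x]; first exact: Quotient.pi_add.
by rewrite /gpi -gquot_act_pi.
Qed.

Lemma gpi_eq M (P : gsubmodule M) x y : gpi P x = gpi P y <-> gsub_set P (x - y).
Proof.
split=> [/eqP|Pxy]; rewrite /gpi.
  by rewrite -Quotient.idealrBE => /asboolP.
by apply/eqP; rewrite -Quotient.idealrBE; apply/asboolP.
Qed.

Lemma gpi_eq0 M (P : gsubmodule M) x : gpi P x = 0 <-> gsub_set P x.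
Proof. by rewrite -[in X in _ <-> X](subr0 x) -gpi_eq (gmod_hom0 (gpi_hom P)). Qed.

Definition grepr M (P : gsubmodule M) (x : gmod_quot P) : M :=
  (repr (x : {ideal_quot gsub_mem P}%qT))%qT.

Lemma greprK M (P : gsubmodule M) x : gpi P (grepr x) = x.
Proof. by rewrite /gpi reprK. Qed.

Lemma grepr_inj M (P : gsubmodule M) : injective (@grepr M P).
Proof. exact: can_inj (@greprK M P). Qed.

Lemma mod2_addff M (x : gmod_mod2 M) : x + x = 0.
Proof.
have [piD _] := gpi_hom (gmod_double M).
by rewrite -(greprK x) -piD; apply/gpi_eq0; exists (grepr x).
Qed.

Definition gpi2 M (P : gsubmodule M) (x : M) : gmod_mod2 (gmod_quot P) :=
  gpi (gmod_double (gmod_quot P)) (gpi P x).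

Lemma gpi2_hom M (P : gsubmodule M) : gmod_hom (gpi2 P).
Proof. exact: gmod_hom_comp (gpi_hom _) (gpi_hom _). Qed.

Lemma gpi2_eq0 M (P : gsubmodule M) x :
  gpi2 P x = 0 <-> exists y, gsub_set P (x - (y + y)).
Proof.
have [piD _] := gpi_hom P; rewrite /gpi2 gpi_eq0; split=> [[y xy]|[y /gpi_eq xy]].
  by exists (grepr y); apply/gpi_eq; rewrite piD greprK.
by exists (gpi P y); rewrite xy piD.
Qed.

Definition grepr2 M (P : gsubmodule M) (x : gmod_mod2 (gmod_quot P)) : M :=
  grepr (grepr x).

Lemma grepr2K M (P : gsubmodule M) x : gpi2 P (grepr2 x) = x.
Proof. by rewrite /gpi2 /grepr2 !greprK. Qed.

(* The map M/(P + 2M) -> M/(Q + 2M) induced by the identity when P is included in Q. *)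
Definition mod2_map M (P Q : gsubmodule M) (x : gmod_mod2 (gmod_quot P)) :
  gmod_mod2 (gmod_quot Q) := gpi2 Q (grepr2 x).

Lemma mod2_map_pi M (P Q : gsubmodule M) : (gsub_set P `<=` gsub_set Q)%classic ->
  forall x, mod2_map Q (gpi2 P x) = gpi2 Q x.
Proof.
move=> PQ x; apply/eqP; rewrite -subr_eq0 -(gmod_homB _ _ (gpi2_hom Q)); apply/eqP/gpi2_eq0.
have : gpi2 P (grepr2 (gpi2 P x) - x) = 0.
  by rewrite (gmod_homB _ _ (gpi2_hom P)) grepr2K subrr.
by move=> /gpi2_eq0[y Py]; exists y; apply: PQ.
Qed.

Lemma mod2_map_hom M (P Q : gsubmodule M) : (gsub_set P `<=` gsub_set Q)%classic ->
  gmod_hom (@mod2_map M P Q).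
Proof.
move=> PQ; have [pD pA] := gpi2_hom P; have [qD qA] := gpi2_hom Q.
split=> [x y|g x].
  by rewrite -(grepr2K x) -(grepr2K y) -pD !(mod2_map_pi PQ) qD.
by rewrite -(grepr2K x) -pA !(mod2_map_pi PQ) qA.
Qed.

(** Pigeonhole on the multiples of x gives a positive j - i <= |T| that kills x, and it divides
    |T|!. *)
Lemma finite_exponent M (T : finType) (c : M -> T) : injective c ->
  exists2 N : nat, (0 < N)%N & forall x : M, x *+ N = 0.
Proof.
move=> c_inj; exists (#|T|)`!; first exact: fact_gt0.
move=> x; have /injectivePn[i [j ij cij]] : ~~ injectiveb (fun i : 'I_#|T|.+1 => c (x *+ i)).
  by apply/negP => /injectiveP/leq_card; rewrite card_ord ltnn.
wlog lt_ij : i j ij cij / (i < j)%N.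
  move=> H; case: (ltngtP i j) => [|lt_ji|/val_inj e]; first exact: H ij cij.
    by apply: H lt_ji; rewrite 1?eq_sym.
  by rewrite e eqxx in ij.
have xk : x *+ (j - i) = 0.
  by rewrite mulrnBr ?(ltnW lt_ij) // (c_inj _ _ cij) subrr.
have /dvdnP[q ->] : (j - i %| (#|T|)`!)%N.
  by apply: dvdn_fact; rewrite subn_gt0 lt_ij (leq_trans (leq_subr _ _)) // -ltnS.
by rewrite mulnC mulrnA xk mul0rn.
Qed.
End Quotients.

(** * Signs of units and the two class groups *)

Section Reflection.
Variables (R : realType) (K : splittingFieldType rat) (F : fieldType).
Local Notation galK := (gal_of {:K}%VS).
Variables (chi : character galK F) (v0 : real_place R K).
Hypothesis F_char2 : 2%:R = 0 :> F.
Hypothesis odd_galK : odd #|{: galK}|.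
Local Notation idemK := (idem chi odd_galK).
Local Notation sgn := (@sgninf R K).
Local Notation Cl := (class_group K).
Local Notation ClP := (narrow_class_group R K).

Let PrincP : gsubmodule (ideals K) := GSubmodule (principal_pos_set0 R K)
  (@principal_pos_setB R K) (@principal_pos_set_stable R K).
Let Princ : gsubmodule (ideals K) := GSubmodule (principal_set0 K)
  (@principal_setB K) (@principal_set_stable K).

Lemma seq_act_principal (s : seq galK) (I : ideals K) x : x != 0 ->
  ideal_set I = principal_ideal x ->
  ideal_set (seq_act s I) = principal_ideal (\prod_(g <- s) g x).
Proof.
move=> x0 Ix; rewrite /seq_act; elim: s => [|g s IHs].
  by rewrite !big_nil principal1.
by rewrite !big_cons -principal_mul -IHs -ideal_gal_principal -Ix.
Qed.

Lemma char_dim_sgn_units : char_dim chi (sgn_units R K) (sgnrk_units R chi).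
Proof.
apply: (multiplicity_char_dim chi F_char2 odd_galK
  (code := fun x : sgn_units R K => Vinf_code v0 (val x))).
  by move=> x y /Vinf_code_inj/val_inj.
by move=> x; apply: val_inj; apply: Vinf_addff.
Qed.

Lemma char_dim_narrow : char_dim chi (gmod_mod2 ClP) (rk_char chi ClP).
Proof.
have [T [c c_inj]] := narrow_class_finite v0.
apply: (multiplicity_char_dim chi F_char2 odd_galK (code := c \o @grepr _ _ _)).
  exact: inj_comp c_inj (@grepr_inj _ _ _).
exact: mod2_addff.
Qed.

(** Cl is a quotient of Cl^+, hence finite: a class is coded by the narrow class of a
    representative. *)
Lemma char_dim_class : char_dim chi (gmod_mod2 Cl) (rk_char chi Cl).
Proof.
have [T [c c_inj]] := narrow_class_finite v0.
apply: (multiplicity_char_dim chi F_char2 odd_galK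
  (code := fun x : gmod_mod2 Cl => c (gpi PrincP (grepr2 x)))); last exact: mod2_addff.
move=> x y /c_inj /gpi_eq [u [u0 _] uE].
rewrite -(grepr2K x) -(grepr2K y); congr (gpi _ _); apply/gpi_eq.
by exists u.
Qed.

Lemma Princ_sub : (gsub_set PrincP `<=` gsub_set Princ)%classic.
Proof. by move=> I [x [x0 _] Ix]; exists x. Qed.

Lemma sgnrk_units_le1 : (sgnrk_units R chi <= 1)%N.
Proof.
have dV := Vinf_char_dim chi v0 F_char2 odd_galK.
apply: (char_dim_le F_char2 odd_galK char_dim_sgn_units dV) => [x|x y _ _].
  exact: (char_part_hom (gmod_hom_val _)).
exact: val_inj.
Qed.

(** A nonzero U[chi] fills V[chi], which makes Cl^+/2 -> Cl/2 injective on chi-parts. *)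
Lemma narrow_rank_le : (0 < sgnrk_units R chi)%N -> (rk_char chi ClP <= rk_char chi Cl)%N.
Proof.
move=> /(char_dim_gt0 F_char2 odd_galK char_dim_sgn_units)[u u0 Pu].
have PV f : char_part chi f -> sgn_units_set (f : Vinf R K).
  move=> Pf; have valH := gmod_hom_val (M := Vinf R K).
  have [||s ->] := @Vinf_part_simple _ _ _ chi v0 F_char2 odd_galK (val u) f _ Pf.
  - exact: char_part_hom (valH _) Pu.
  - by [].
  by rewrite -(gmod_hom_seq_act s u (valH _)); have /asboolP := valP (seq_act s u).
have hH : gmod_hom (@mod2_map _ _ PrincP Princ) := mod2_map_hom Princ_sub.
apply: (char_dim_le F_char2 odd_galK char_dim_narrow char_dim_class
  (h := @mod2_map _ _ PrincP Princ)) => [x|x y Px Py]; first exact: char_part_hom.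
move=> /eqP; rewrite -subr_eq0 -(gmod_homB _ _ hH) => /eqP hz.
apply/eqP; rewrite -subr_eq0; apply/eqP; move: (char_partB Px Py) hz.
(* The representative of [z] is 2J plus the principal ideal of [a], so z = e z is the class of the
   ideal generated by e a. *)
move: (x - y) => z Pz /gpi2_eq0[J [a a0 aE]].
rewrite -(idem_act_id F_char2 odd_galK Pz) -(grepr2K z).
have -> : gpi2 PrincP (grepr2 z) = gpi2 PrincP (grepr2 z - (J + J)).
  have [pD _] := gpi2_hom PrincP.
  by rewrite (gmod_homB _ _ (gpi2_hom PrincP)) pD mod2_addff subr0.
rewrite -(gmod_hom_seq_act _ _ (gpi2_hom PrincP)); apply/gpi2_eq0; exists 0.
rewrite !addr0 subr0 /=; have [a'0 sa'] := @sgninf_prod R K idemK a a0.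
(* The signs of e a lie in V[chi], hence come from a unit u', and e a / u' is a totally positive
   generator of the same ideal. *)
have /PV[u' [u'0 Ou' Ou'V] su'] : char_part chi (seq_act idemK (sgn a : Vinf R K)).
  by apply: char_part_idem => //; apply: Vinf_addff.
exists ((\prod_(g <- idemK) g a) / u').
  split; first by rewrite mulf_neq0 ?invr_eq0.
  by apply: sgninf_eq_pos => //; rewrite sa' su'.
rewrite (seq_act_principal _ a0 aE); apply/seteqP; split=> _ [d Od <-].
  by exists (u' * d); [apply: intringM | rewrite mulrA mulfVK].
by exists (u'^-1 * d); [apply: intringM | rewrite mulrA].
Qed.

Lemma sgnrk_units_neq0 : rk_char chi ClP = 0%N -> sgnrk_units R chi != 0%N.
Proof.
move=> rk0; apply/eqP => sgn0.
have dU := char_dim_sgn_units; rewrite sgn0 in dU.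
have dB := char_dim_narrow; rewrite rk0 in dB.
pose f := Vinf_gen chi v0 odd_galK.
have Pf : char_part chi f by apply: Vinf_gen_part.
have f0 : f != 0 by apply: Vinf_gen_neq0.
have [a a0 aE] := sgninf_surj v0 f.
pose I : ideals K := mk_ideal (principal_invertible a0).
have IE : ideal_set I = principal_ideal a by [].
pose w : ClP := gpi PrincP I.
have w0 : w <> 0.
  (* If c is a totally positive generator of the ideal of [a], then d = a / c is a unit with signs
     [f], contradicting U[chi] = 0. *)
  move=> /gpi_eq0[c [c0 cpos]]; rewrite IE => ac.
  have [d Od da] : principal_ideal c a by rewrite -ac; exists 1; [exact: intring1|rewrite mulr1].
  have [d' Od' d'c] : principal_ideal a c by rewrite ac; exists 1; [exact: intring1|rewrite mulr1].
  have d0 : d != 0.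
    by move: (a0); rewrite -da mulf_eq0 negb_or => /andP[].
  have dV : d' = d^-1.
    by apply: (mulfI a0); rewrite d'c -da mulfK.
  have fU : sgn_units_set f.
    exists d; first by split; rewrite -?dV.
    by rewrite -aE -da sgninfM // (totally_positive_sgninf cpos) add0r.
  have fUm : f \in gsub_mem (GSubmodule (sgn_units0 R K) (@sgn_unitsB R K) (@sgn_units_stable R K)).
    exact/asboolP.
  pose u : sgn_units R K := exist (fun z => z \in gsub_mem _) f fUm.
  have Pu : char_part chi u.
    by apply: (char_part_hom_inj (gmod_hom_val _)) => //; apply: val_inj.
  by have := congr1 val (char_dim0 dU Pu) => /= fz; rewrite fz eqxx in f0.
have [piD piA] := gpi_hom PrincP.
(* The square of [a] is totally positive. *)
have w2 : w + w = 0.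
  rewrite -piD; apply/gpi_eq0; exists (a * a); last by rewrite -principal_mul.
  split; first by rewrite mulf_neq0.
  by move=> v; rewrite rmorphM -expr2 exprn_even_gt0 //= fmorph_eq0.
(* e fixes the signs [f] of [a], so e a / a is totally positive. *)
have we : seq_act idemK w = w.
  rewrite -(gmod_hom_seq_act _ _ (gpi_hom PrincP)); apply/gpi_eq.
  have [a'0 sa'] := @sgninf_prod R K idemK a a0.
  exists ((\prod_(g <- idemK) g a) / a).
    split; first by rewrite mulf_neq0 ?invr_eq0.
    by apply: sgninf_eq_pos => //; rewrite sa' aE (idem_act_id F_char2 odd_galK Pf).
  by apply: ideal_setB_principal => //; apply: seq_act_principal.
(* The image of e x in Cl^+/2 lies in the chi-part, which is zero. *)
have e2 (x : ClP) : exists y, seq_act idemK x = y + y.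
  have piH := gpi_hom (gmod_double ClP).
  have : char_part chi (seq_act idemK (gpi (gmod_double ClP) x)).
    by apply: char_part_idem => //; apply: mod2_addff.
  by move=> /(char_dim0 dB); rewrite -(gmod_hom_seq_act _ _ piH) => /gpi_eq0.
(* Applying e to w = 2^k y fixes w and replaces y by some 2z. *)
have wdiv k : exists y : ClP, w = y *+ (2 ^ k).
  elim: k => [|k [y wy]]; first by exists w.
  have [z zE] := e2 y; exists z.
  by rewrite -we wy seq_actMn zE -mulr2n -mulrnA expnS.
have [T [c c_inj]] := narrow_class_finite v0.
have [N N0 expN] := finite_exponent c_inj.
(* Write the exponent as N = o 2^k with o odd: then o w = w because 2w = 0, while o w = o 2^k y = N
   y = 0. *)
have [o] := pfactor_coprime (isT : prime 2) N0; rewrite coprime2n => odd_o NE.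
apply: w0; have [y wy] := wdiv (logn 2 N).
have <- : w *+ o = w.
  by rewrite -(odd_double_half o) odd_o -mul2n mulrnDr mulrnA mulr2n w2 mul0rn addr0.
by rewrite wy -mulrnA mulnC -NE expN.
Qed.
End Reflection.

Theorem theorem4p21 (R : realType) (K : splittingFieldType rat)
    (F2bar : closedFieldType) (iota : {rmorphism 'F_2 -> F2bar})
    (F2bar_algebraic : integralRange iota)
    (abelK : abelian 'Gal({:K} / 1)) (oddK : odd (\dim {:K}))
    (chi : character (gal_of {:K}) F2bar) :
  (kplus_char R chi = 1 -> sgnrk_units R chi = 0%N) /\
  (kplus_char R chi = 0 ->
     Num.max 0 (1 - (rho_char chi)%:Z) <= (sgnrk_units R chi)%:Z <= 1).
Proof.
have F_char2 : 2%:R = 0 :> F2bar.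
  by rewrite -(rmorph_nat iota) -[RHS](rmorph0 iota); congr (iota _); apply: val_inj.
have odd_galK : odd #|{: gal_of {:K}%VS}| by rewrite card_galK.
have [v0 _] := real_place_ex R oddK.
have le1 := sgnrk_units_le1 chi v0 F_char2 odd_galK.
have le := narrow_rank_le (chi := chi) v0 F_char2 odd_galK.
have neq0 := sgnrk_units_neq0 (chi := chi) v0 F_char2 odd_galK.
rewrite /kplus_char /rho_char; split=> [k1|k0].
  (* A positive signature rank would force k^+ <= 0. *)
  case: (posnP (sgnrk_units R chi)) => // /le.
  by lia.
rewrite ge_max.
(* If rho = 0, then k^+ = 0 makes the narrow rank 0 as well, so the signature rank is nonzero; if
   rho > 0, the lower bound is 0. *)
have [r0|r0] := posnP (rk_char chi (class_group K)); last by lia.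
have : sgnrk_units R chi != 0%N by apply: neq0; lia.
by lia.
Qed.
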